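(* For every positive integer $k$ there exists $n_0=n_0(k)$ such that the following holds. Let $n,t$ be positive integers with $n\ge n_0$ and $n>2kt$. Let $F_1,\ldots,F_t\subseteq \binom{[n]}{k}$. If $$|F_i|>\binom{n}{k}-\binom{n-t+1}{k}\quad\text{for all } 1\le i\le t,$$ then $\{F_1,\ldots,F_t\}$ admits a rainbow matching, i.e. there exist $e_i\in F_i$ for $i\in[t]$ such that $e_1,\ldots,e_t$ are pairwise disjoint.
   Context: $[n]=\{1,\ldots,n\}$, and $\binom{[n]}{k}$ is the set of all $k$-element subsets of $[n]$. The $F_i$ are not required to be distinct. *)

(* Defs.v *)
From mathcomp Require Import all_boot.

Set Implicit Arguments.
Unset Strict Implicit.
Unset Printing Implicit Defensive.

(* The ground set [n] = {1, ..., n} is represented by 'I_n = {0, ..., n.-1}. *)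
Definition ksubsets (n k : nat) : {set {set 'I_n}} := [set A : {set 'I_n} | #|A| == k].

(* The F i are indexed, so they need not be distinct. *)
Definition has_rainbow_matching (n t : nat) (F : 'I_t -> {set {set 'I_n}}) : Prop :=
  exists e : 'I_t -> {set 'I_n},
    (forall i, e i \in F i) /\
    (forall i j, i != j -> [disjoint e i & e j]).

(* Main.v *)
Require Import Defs.
From mathcomp Require Import all_boot.
From mathcomp Require Import perm order ssralg ssrnum ssrint.
From mathcomp Require Import zify ring.

Set Implicit Arguments.
Unset Strict Implicit.
Unset Printing Implicit Defensive.

(* Compression reduces the theorem to shifted families. Suppose that some F_i has an edge
   {a} + B through the lowest vertex a with B above a + k (t - 1). By induction the other
   families have a rainbow matching avoiding a, shifting moves it into
   a + 1, ..., a + k (t - 1), and {a} + B can be added. Otherwise every F_i is "blocked".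
   Then all edges have two vertices among the k (t - 1) + 1 lowest ones, which contradicts
   the size of F_i if t is bounded. If t is large, Frankl's proof of the Erdos matching
   conjecture for n > 2 k t has slack for blocked families: each F_i has, on its own, a
   matching of size t avoiding the h lowest vertices, where h = c_k t. Choose one edge
   from each of these t matchings so that the numbers of chosen edges' vertices in initial
   segments deviate little from their averages. The average over [a, q] is at most
   q + 1 - a - h, so the h spare positions absorb the deviations, each segment [a, q]
   carries at most q + 1 - a vertices, and shifting makes the chosen edges disjoint. *)

(** * Compression *)

(** The floor [b] limits the targets [y], so that the edges of a shifted family lying in [above n b]
    again form a family shifted with floor [b]. *)
Definition shifted (n b : nat) (F : {set {set 'I_n}}) : Prop :=
  forall (e : {set 'I_n}) (x y : 'I_n), e \in F -> x \in e -> y \notin e ->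
  b <= y -> y < x -> y |: e :\ x \in F.

Section TpermImset.
Variable T : finType.
Implicit Types (x y z : T) (e : {set T}).

Lemma mem_tperm_imset x y z e : (z \in tperm x y @: e) = (tperm x y z \in e).
Proof. by rewrite -{1}[z](tpermK x y) mem_imset //; apply: perm_inj. Qed.

Lemma tperm_imset x y e : x \in e -> y \notin e -> tperm x y @: e = y |: e :\ x.
Proof.
move=> xe ye; apply/setP => z; rewrite mem_tperm_imset !inE.
case: tpermP => [->|->|/eqP/negPf-> /eqP/negPf->] //.
- by rewrite (negPf ye) eqxx; case: eqP xe ye => // -> ->.
- by rewrite eqxx.
Qed.

Lemma tperm_imset_id x y e : x \notin e -> y \notin e -> tperm x y @: e = e.
Proof.
move=> xe ye; apply/setP => z; rewrite mem_tperm_imset.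
by case: tpermP => [->|->|] //; rewrite (negPf xe) (negPf ye).
Qed.

Lemma tperm_imsetK x y : involutive (fun e => tperm x y @: e).
Proof. by move=> e; apply/setP => z; rewrite !mem_tperm_imset tpermK. Qed.

Lemma tperm_imset_inj x y : injective (fun e => tperm x y @: e).
Proof. exact: inv_inj (@tperm_imsetK x y). Qed.

End TpermImset.

Section Compression.
Variable n : nat.
Implicit Types (x y z : 'I_n) (e : {set 'I_n}) (F : {set {set 'I_n}}).

(** The classical shift of extremal set theory, written with a transposition so that size and
    disjointness carry over by injectivity. *)
Definition compress_edge x y F e :=
  if [&& x \in e, y \notin e & tperm x y @: e \notin F] then tperm x y @: e else e.

Definition compress x y F := compress_edge x y F @: F.

(** A moved edge lands outside [F], so it cannot coincide with a kept one. *)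
Lemma compress_edge_inj x y F : {in F &, injective (compress_edge x y F)}.
Proof.
move=> e e' eF e'F; rewrite /compress_edge.
case: ifP => [/and3P[_ _ ne]|_]; case: ifP => [/and3P[_ _ ne']|_] //.
- by apply: imset_inj; apply: perm_inj.
- by move=> E; rewrite E e'F in ne.
- by move=> E; rewrite -E eF in ne'.
Qed.

Lemma card_compress x y F : #|compress x y F| = #|F|.
Proof. exact/card_in_imset/compress_edge_inj. Qed.

Lemma compress_ksubsets k x y F :
  F \subset ksubsets n k -> compress x y F \subset ksubsets n k.
Proof.
move=> /subsetP FK; apply/subsetP => _ /imsetP[e eF ->].
have := FK _ eF; rewrite !inE /compress_edge; case: ifP => // _.
by rewrite card_imset //; apply: perm_inj.
Qed.

Lemma mem_compress x y F e : e \in compress x y F ->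
  (e \in F /\ (x \in e -> y \notin e -> tperm x y @: e \in F)) \/
  [/\ y \in e, x \notin e & tperm x y @: e \in F].
Proof.
move=> /imsetP[d dF ->]; rewrite /compress_edge.
case: ifP => [/and3P[xd yd _]|H].
  right; rewrite !mem_tperm_imset tpermL tpermR; split=> //.
  rewrite -imset_comp (eq_imset (g := id)) ?imset_id // => z /=.
  exact: tpermK.
left; split=> // xd yd; move: H; rewrite xd yd /=.
by case: (_ \in F).
Qed.

(** If [e i0] is not in [F i0], it contains [y] and its swap lies in [F i0]. Swapping [x] and [y] in
    every edge then works: the other edges avoid [y], so each is either fixed by the swap or was
    kept because its swap is already present. *)
Lemma compress_rainbow t x y (F : 'I_t -> {set {set 'I_n}}) :
  has_rainbow_matching (fun i => compress x y (F i)) -> has_rainbow_matching F.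
Proof.
move=> [e [eF edis]].
have [/existsP[i0 ni0]|] := boolP [exists i, e i \notin F i]; last first.
  rewrite negb_exists => /forallP all; exists e; split=> // i.
  by have := all i; rewrite negbK.
exists (fun i => tperm x y @: e i); split=> [i|i j ij]; last first.
  by rewrite imset_disjoint ?edis //; apply: perm_inj.
case: (mem_compress (eF i0)) => [[] |[yi0 xi0 si0]]; first by rewrite (negPf ni0).
have [->//|ne] := eqVneq i i0.
have yi : y \notin e i.
  by have /disjointFl := edis _ _ ne; move/(_ _ yi0) => ->.
case: (mem_compress (eF i)) => [[iF H] |[]]; last by rewrite (negPf yi).
have [xi|xi] := boolP (x \in e i); first exact: H.
by rewrite tperm_imset_id.
Qed.

Definition weight F := \sum_(e in F) \sum_(z in e) (z : nat).

Lemma sum_move_lt x y e : x \in e -> y \notin e -> y < x ->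
  \sum_(z in y |: e :\ x) (z : nat) < \sum_(z in e) (z : nat).
Proof.
move=> xe ye yx; rewrite big_setU1 ?inE ?(negPf ye) ?andbF //=.
by rewrite [X in _ < X](big_setD1 x) //= ltn_add2r.
Qed.

Lemma weight_compress_lt x y F e : e \in F -> x \in e -> y \notin e -> y < x ->
  y |: e :\ x \notin F -> weight (compress x y F) < weight F.
Proof.
move=> eF xe ye yx neF.
rewrite /weight big_imset /=; last exact: compress_edge_inj.
rewrite (big_setD1 e) //= [X in _ < X](big_setD1 e) //=.
rewrite -addSn; apply: leq_add.
  by rewrite /compress_edge xe ye tperm_imset // neF /= sum_move_lt.
apply: leq_sum => d _; rewrite /compress_edge.
case: ifP => // /and3P[xd yd _]; rewrite tperm_imset //.
exact/ltnW/sum_move_lt.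
Qed.

(** Induction on the total weight: all families are compressed along the same pair, which lowers the
    weight of the offending family and raises no other. *)
Lemma exists_shifted k t (F : 'I_t -> {set {set 'I_n}}) :
  (forall i, F i \subset ksubsets n k) ->
  exists G : 'I_t -> {set {set 'I_n}},
    [/\ forall i, shifted 0 (G i), forall i, G i \subset ksubsets n k,
        forall i, #|G i| = #|F i| & has_rainbow_matching G -> has_rainbow_matching F].
Proof.
have [w] := ubnP (\sum_i weight (F i)).
elim: w F => // w IH F /ltnSE wF FK.
have [/forallP shF|] := boolP [forall i, forall e in F i, forall x in e, forall y,
    (y \notin e) && (y < x) ==> (y |: e :\ x \in F i)].
  exists F; split=> // i e x y eF xe ye _ yx.
  have /forallP/(_ e)/implyP/(_ eF)/forallP/(_ x)/implyP/(_ xe)/forallP/(_ y) := shF i.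
  by rewrite ye yx.
rewrite negb_forall => /existsP[i]; rewrite negb_forall => /existsP[e].
rewrite negb_imply negb_forall => /andP[eF /existsP[x]].
rewrite negb_imply negb_forall => /andP[xe /existsP[y]].
rewrite negb_imply => /andP[/andP[ye yx] neF].
have [||G [shG GK cG rG]] := IH (fun i => compress x y (F i)).
- apply: leq_trans wF.
  rewrite (bigD1 i) //= [X in _ < X](bigD1 i) //= -addSn leq_add //.
    exact: weight_compress_lt neF.
  apply: leq_sum => j _; have [/existsP[d /and4P[dF xd yd nd]]|] :=
    boolP [exists d, [&& d \in F j, x \in d, y \notin d & y |: d :\ x \notin F j]].
    exact/ltnW/(weight_compress_lt dF).
  rewrite negb_exists => /forallP nex.
  rewrite /weight big_imset /=; last exact: compress_edge_inj.
  apply: leq_sum => d dF; rewrite /compress_edge; case: ifP => // /and3P[xd yd].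
  by have := nex d; rewrite dF xd yd /= negbK tperm_imset // => ->.
- by move=> j; apply: compress_ksubsets.
exists G; split=> // [j|/rG /compress_rainbow //].
by rewrite cG card_compress.
Qed.

End Compression.

(** * Pushing a system of edges down *)

Definition above (n a : nat) : {set 'I_n} := [set x : 'I_n | a <= x].

(** Incidences are counted with multiplicity, so the demand of the edges can be compared with the
    room in an initial segment. *)
Definition load (n : nat) (I : finType) (J : {set I}) (g : I -> {set 'I_n}) (q : nat) :=
  \sum_(i in J) #|[set z in g i | z <= q]|.

Section Settling.
Variables (n : nat) (I : finType) (J : {set I}).
Implicit Types (g : I -> {set 'I_n}) (e : {set 'I_n}) (x y z : 'I_n).

Lemma card_initialS e z q : z = q.+1 :> nat ->
  #|[set x in e | x <= q.+1]| = #|[set x in e | x <= q]| + (z \in e).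
Proof.
move=> zq; rewrite (cardsD1 z [set x in e | x <= q.+1]) !inE zq leqnn andbT addnC.
congr (_ + _); apply: eq_card => x; rewrite !inE.
rewrite -val_eqE /= zq; case: (x \in e); rewrite ?andbF //=; lia.
Qed.

Lemma loadS g z q : z = q.+1 :> nat ->
  load J g q.+1 = load J g q + \sum_(i in J) (z \in g i).
Proof.
by move=> zq; rewrite /load -big_split; apply: eq_bigr => i _; apply: card_initialS.
Qed.

Lemma load_gt0 g i x q : i \in J -> x \in g i -> x <= q -> 0 < load J g q.
Proof.
move=> iJ xi xq; rewrite /load (bigD1 i) //= addn_gt0 card_gt0.
by apply/orP; left; apply/set0Pn; exists x; rewrite inE xi.
Qed.

Lemma load_mono g q q' : q <= q' -> load J g q <= load J g q'.
Proof.
move=> qq'; apply: leq_sum => i _; apply/subset_leq_card/subsetP => z.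
by rewrite !inE => /andP[-> zq]; apply: leq_trans qq'.
Qed.

Lemma load_le_card k g q : (forall i, i \in J -> #|g i| = k) -> load J g q <= k * #|J|.
Proof.
move=> gk; apply: (leq_trans (n := \sum_(i in J) k)); last by rewrite sum_nat_const mulnC.
apply: leq_sum => i iJ; rewrite -(gk i iJ); apply/subset_leq_card/subsetP => z.
by rewrite inE => /andP[].
Qed.

Lemma card_move e x y : x \in e -> y \notin e -> #|y |: e :\ x| = #|e|.
Proof.
move=> xe ye; rewrite cardsU1 !inE (negPf ye) andbF /=.
by rewrite (cardsD1 x e) xe.
Qed.

Definition move_vertex g i x y j := if j == i then y |: g i :\ x else g j.

Lemma card_initial_move e x y q : x \in e -> y \notin e -> y < x ->
  #|[set z in y |: e :\ x | z <= q]| <= #|[set z in e | z <= q]| + (y <= q < x).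
Proof.
move=> xe ye yx; have [qy|yq] := ltnP q y.
  rewrite addn0; apply/subset_leq_card/subsetP => z; rewrite !inE.
  case: eqP => [->|_] /=; first by rewrite leqNgt qy.
  by case/andP => /andP[_ ->].
have [qx|xq] := ltnP q x; rewrite /= ?addn1 ?addn0.
  apply: (@leq_trans #|y |: [set z in e | z <= q]|); last by rewrite cardsU1; case: (_ \notin _).
  apply/subset_leq_card/subsetP => z; rewrite !inE.
  by case: eqP => //= _ /andP[/andP[_ ->]].
rewrite -(@card_move [set z in e | z <= q] x y) ?inE ?xe ?xq ?(negPf ye) //.
apply/subset_leq_card/subsetP => z; rewrite !inE.
by case: eqP => //= _ /andP[/andP[-> ->] ->].
Qed.

Lemma load_move_vertex g i x y q : i \in J -> x \in g i -> y \notin g i -> y < x ->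
  load J (move_vertex g i x y) q <= load J g q + (y <= q < x).
Proof.
move=> iJ xi yi yx; rewrite /load (bigD1 i) //= [X in _ <= X + _](bigD1 i) //=.
rewrite addnAC leq_add //; first by rewrite /move_vertex eqxx card_initial_move.
by apply: leq_sum => j /andP[_ /negPf ji]; rewrite /move_vertex ji.
Qed.

(* If [x] could not be moved to any hole [y], then the slack [load q + a <= q] would
   propagate from [x - 1] down to [a], every position on the way being occupied by [g i];
   but [a] itself being occupied contradicts the slack at [a]. *)
Lemma exists_hole a g i x : i \in J -> x \in g i -> a < x -> load J g x.-1 + a < x ->
  exists y, [/\ y \notin g i, a <= y, y < x &
    forall q, y <= q < x -> load J g q + a <= q].
Proof.
move=> iJ xi ax lx.
have [/existsP[y /and4P[yi ay yx /forallP H]]|] := boolP [exists y : 'I_n,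
  [&& y \notin g i, a <= y, y < x & [forall q : 'I_n, (y <= q < x) ==> (load J g q + a <= q)]]].
  exists y; split=> // q yqx; have qn : q < n by have := ltn_ord x; lia.
  by have := H (Ordinal qn); rewrite /= yqx.
rewrite negb_exists => /forallP nex.
have mem y : a <= y -> y < x -> (forall q, y <= q < x -> load J g q + a <= q) -> y \in g i.
  move=> ay yx H; apply: contraR (nex y) => yi; apply/and4P; split=> //.
  by apply/forallP => q; apply/implyP/H.
have slack d q : x <= q + d.+1 -> a <= q < x -> load J g q + a <= q.
  elim: d q => [|d IH] q qd /andP[aq qx].
    by have -> : q = x.-1; lia.
  have [?|qx'] := leqP x (q + d.+1); first by apply: IH => //; rewrite aq.
  have q1n : q.+1 < n by have := ltn_ord x; lia.
  have q1 : Ordinal q1n \in g i.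
    by apply: mem => /= [||p pq]; [lia|lia|apply: IH; lia].
  have l1 : load J g q.+1 + a <= q.+1 by apply: IH; lia.
  have := @loadS g (Ordinal q1n) q erefl; rewrite (bigD1 i) //= q1; lia.
have an : a < n by apply: ltn_trans (ltn_ord x).
have ai : Ordinal an \in g i by apply: mem => //= q qx; apply: (slack x); lia.
have := slack x a; have := load_gt0 iJ ai (leqnn a); lia.
Qed.

(** Induction on the sum of all vertices. A vertex [x] that is too high or lies in two edges forces
    slack at [x - 1], so [exists_hole] allows it to move down. When there is no such vertex, the
    edges are low and disjoint. *)
Lemma settle k a (F : I -> {set {set 'I_n}}) g :
  (forall i, i \in J -> shifted a (F i)) ->
  (forall i e, i \in J -> e \in F i -> #|e| = k) ->
  (forall i, i \in J -> g i \in F i) ->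
  (forall i, i \in J -> g i \subset above n a) ->
  (forall q, a <= q -> load J g q + a <= q.+1) ->
  exists g', [/\ forall i, i \in J -> g' i \in F i,
    forall i, i \in J -> g' i \subset above n a,
    forall i x, i \in J -> x \in g' i -> x < a + k * #|J| &
    forall i j, i \in J -> j \in J -> i != j -> [disjoint g' i & g' j]].
Proof.
move=> shF kF; have [w] := ubnP (\sum_(i in J) \sum_(z in g i) (z : nat)).
elim: w g => // w IH g /ltnSE wg gF ga gl.
have step i x : i \in J -> x \in g i -> a < x -> load J g x.-1 + a < x ->
    exists g', [/\ forall i, i \in J -> g' i \in F i,
      forall i, i \in J -> g' i \subset above n a,
      forall i x, i \in J -> x \in g' i -> x < a + k * #|J| &
      forall i j, i \in J -> j \in J -> i != j -> [disjoint g' i & g' j]].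
  move=> iJ xi ax lx; have [y [yi ay yx yl]] := exists_hole iJ xi ax lx.
  apply: (IH (move_vertex g i x y)).
  - apply: leq_trans wg; rewrite (bigD1 i) //= [X in _ < X](bigD1 i) //= -addSn leq_add //.
      by rewrite /move_vertex eqxx sum_move_lt.
    by apply: leq_sum => j /andP[_ /negPf ji]; rewrite /move_vertex ji.
  - move=> j jJ; rewrite /move_vertex; case: eqP => [->|_]; last exact: gF.
    by apply: shF => //; apply: gF.
  - move=> j jJ; rewrite /move_vertex; case: eqP => [ji|_]; last exact: ga.
    apply/subsetP => z; rewrite !inE => /orP[/eqP->//|/andP[_ zi]].
    by have /subsetP/(_ _ zi) := ga i iJ; rewrite inE.
  (* The move raises the load only for [y <= q < x], which is where [yl] provides a spare unit. *)
  - move=> q aq; have := load_move_vertex q iJ xi yi yx; have := gl q aq.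
    by case: (boolP (y <= q < x)) => [/yl|_]; lia.
have gk i : i \in J -> #|g i| = k by move=> iJ; apply: kF (gF i iJ).
have [/existsP[i /andP[iJ /existsP[x /andP[xi hx]]]]|nhigh] := boolP [exists i in J,
    [exists x in g i, a + k * #|J| <= x]].
  have l1 := load_gt0 iJ xi (leqnn x); have l2 := load_le_card x gk.
  have ax : a < x by lia.
  apply: (step i x) => //.
  have xS : x = x.-1.+1 :> nat by lia.
  have := @loadS g x x.-1 xS; rewrite -xS (bigD1 i) //= xi; lia.
have [/existsP[i /andP[iJ /existsP[j /andP[jJ /andP[ij ndij]]]]]|ndis] := boolP [exists i in J,
    [exists j in J, (i != j) && ~~ [disjoint g i & g j]]].
  move: ndij => /pred0Pn[x /andP[/= xi xj]].
  have ax : a <= x by have /subsetP/(_ _ xi) := ga i iJ; rewrite inE.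
  have lx := gl x ax.
  have x2 : 1 < \sum_(l in J) (x \in g l).
    rewrite (bigD1 i) //= (bigD1 j) /=; last by rewrite jJ eq_sym.
    by rewrite xi xj.
  have ll : \sum_(l in J) (x \in g l) <= load J g x.
    apply: leq_sum => l _; have [xl|//] := boolP (x \in g l).
    by rewrite card_gt0; apply/set0Pn; exists x; rewrite inE xl /=.
  have ax' : a < x by lia.
  apply: (step i x) => //.
  have xS : x = x.-1.+1 :> nat by lia.
  have := @loadS g x x.-1 xS; rewrite -xS; move: x2; move: (\sum_(l in J) (x \in g l)) => S; lia.
exists g; split=> // [i x iJ xi|i j iJ jJ ij].
  rewrite ltnNge; apply: contra nhigh => hx; apply/existsP; exists i; rewrite iJ.
  by apply/existsP; exists x; rewrite xi.
apply: contraR ndis => nd; apply/existsP; exists i; rewrite iJ.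
by apply/existsP; exists j; rewrite jJ ij.
Qed.

End Settling.

(** * Selecting one edge from each matching *)

Lemma card_interval n b c : #|[set z : 'I_n | b <= z < c]| = minn c n - b.
Proof.
rewrite -sum1dep_card big_mkcond /=.
elim: n => [|n IH]; first by rewrite big_ord0 minn0.
by rewrite big_ord_recr /= IH; case: ifP; lia.
Qed.

Lemma card_above n a : #|above n a| = n - a.
Proof.
rewrite -[n in RHS]minnn -card_interval; apply: eq_card => z.
by rewrite !inE ltn_ord andbT.
Qed.

Lemma sum_card_disjoint (I T : finType) (A : I -> {set T}) :
  (forall i j, i != j -> [disjoint A i & A j]) ->
  \sum_i #|A i| = #|\bigcup_i A i|.
Proof.
move=> dA; rewrite -sum1_card partition_disjoint_bigcup //.
by apply: eq_bigr => i _; rewrite sum1_card.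
Qed.

(** The truncated edges are disjoint subsets of [[b, q]]. *)
Lemma load_disjoint n b (I : finType) (J : {set I}) (g : I -> {set 'I_n}) q :
  (forall i, i \in J -> g i \subset above n b) ->
  (forall i i', i \in J -> i' \in J -> i != i' -> [disjoint g i & g i']) ->
  load J g q <= q.+1 - b.
Proof.
(* Indices outside [J] get the empty set, since [sum_card_disjoint] sums over the whole index
   type. *)
move=> gb gd; pose A i := if i \in J then [set z in g i | z <= q] else set0.
have AJ : load J g q = \sum_i #|A i|.
  rewrite /load big_mkcond; apply: eq_bigr => i _; rewrite /A.
  by case: ifP => //; rewrite cards0.
have Ag i : A i \subset g i.
  by rewrite /A; case: ifP; rewrite ?sub0set // => _; apply/subsetP => z /setIdP[].
rewrite AJ sum_card_disjoint => [|i i' ii']; last first.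
  have [iJ|iJ] := boolP (i \in J); last by rewrite /A (negPf iJ) disjoints_subset sub0set.
  have [i'J|i'J] := boolP (i' \in J); first by apply: disjointW (Ag _) (Ag _) (gd _ _ _ _ _).
  by rewrite disjoint_sym /A (negPf i'J) disjoints_subset sub0set.
apply: (@leq_trans #|[set z : 'I_n | b <= z < q.+1]|); last first.
  by rewrite card_interval; lia.
apply/subset_leq_card/bigcupsP => i _; rewrite /A; case: ifP => [iJ|]; last by rewrite sub0set.
apply/subsetP => z /setIdP[/(subsetP (gb i iJ))]; rewrite !inE ltnS => -> //.
Qed.

Section Selection.
Import Order.TTheory GRing.Theory Num.Theory.
Local Open Scope ring_scope.

Lemma Posz_sum (I : Type) (r : seq I) (P : pred I) (f : I -> nat) :
  (\sum_(i <- r | P i) f i)%N%:Z = \sum_(i <- r | P i) (f i)%:Z.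
Proof. exact: (big_morph Posz PoszD). Qed.

Lemma sum_constz t (A : int) : \sum_(l < t) A = t%:Z * A.
Proof. by rewrite sumr_const card_ord -mulr_natl natz. Qed.

Lemma exists_le_average t (f : 'I_t -> int) A : (0 < t)%N ->
  \sum_l f l <= t%:Z * A -> exists l, f l <= A.
Proof.
move=> t0 H; have [/existsP[l fl]|] := boolP [exists l, f l <= A]; first by exists l.
rewrite negb_exists => /forallP nf; exfalso.
suff : t%:Z * (A + 1) <= \sum_l f l by lia.
have -> : t%:Z * (A + 1) = \sum_(l < t) (A + 1).
  by rewrite sumr_const card_ord -mulr_natl natz.
by apply: ler_sum => l _; have := nf l; lia.
Qed.

(* Method of conditional expectations: when [c i] is uniform, the cross terms of the
   quadratic potential vanish on average. *)
Lemma exists_small_discrepancy (I : finType) (J : {set I}) t Q (u : I -> 'I_t -> nat -> int) B :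
  (0 < t)%N ->
  (forall i r, i \in J -> \sum_l u i l r = 0) ->
  (forall i l r, i \in J -> u i l r ^+ 2 <= B) ->
  exists c : I -> 'I_t,
    \sum_(r < Q) (\sum_(i in J) u i (c i) r) ^+ 2 <= (#|J| * Q)%:Z * B.
Proof.
move=> t0; have [m] := ubnP #|J|; elim: m J => // m IH J /ltnSE Jm u0 uB.
have [->|/set0Pn[i iJ]] := eqVneq J set0.
  exists (fun=> Ordinal t0); rewrite cards0 mul0n mul0r big1 // => r _.
  by rewrite big_set0 expr0n.
have iS j : j \in J :\ i -> j \in J by rewrite inE => /andP[].
have [||| c cB] := IH (J :\ i).
- by move: Jm; rewrite (cardsD1 i) iJ.
- by move=> j r /iS; apply: u0.
- by move=> j l r /iS; apply: uB.
set D := fun r : nat => \sum_(j in J :\ i) u j (c j) r.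
have [|l lB] := @exists_le_average t (fun l => \sum_(r < Q) (D r + u i l r) ^+ 2)
  (\sum_(r < Q) D r ^+ 2 + Q%:Z * B) t0.
  rewrite exchange_big /=.
  have -> : t%:Z * (\sum_(r < Q) D r ^+ 2 + Q%:Z * B) = \sum_(r < Q) t%:Z * (D r ^+ 2 + B).
    by rewrite -mulr_sumr big_split /= sum_constz.
  apply: ler_sum => r _.
  have -> : \sum_(l < t) (D r + u i l r) ^+ 2 =
      t%:Z * D r ^+ 2 + D r * 2 * \sum_(l < t) u i l r + \sum_(l < t) u i l r ^+ 2.
    rewrite -sum_constz mulr_sumr -!big_split /=.
    by apply: eq_bigr => l _; ring.
  rewrite u0 // mulr0 addr0 mulrDr lerD2l.
  by rewrite -sum_constz; apply: ler_sum => l _; apply: uB.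
exists (fun j => if j == i then l else c j).
have -> : \sum_(r < Q) (\sum_(j in J) u j (if j == i then l else c j) r) ^+ 2 =
    \sum_(r < Q) (D r + u i l r) ^+ 2.
  apply: eq_bigr => r _; rewrite (big_setD1 i) //= eqxx addrC; congr ((_ + _) ^+ 2).
  by apply: eq_bigr => j; rewrite !inE => /andP[/negPf-> _].
apply: (le_trans lB); rewrite (cardsD1 i J) iJ add1n mulSn PoszD mulrDl addrC lerD2l.
exact: cB.
Qed.

Lemma sum_squares_ge (h : nat) : (h ^ 3 <= 3 * \sum_(j < h) (h - j) ^ 2)%N.
Proof.
elim: h => [|h IH]; first by rewrite big_ord0.
rewrite big_ord_recl subn0 mulnDr.
have -> : (\sum_(i < h) (h.+1 - lift ord0 i) ^ 2 = \sum_(i < h) (h - i) ^ 2)%N.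
  by apply: eq_bigr.
by move: IH; nia.
Qed.

(** If the load at [q] were too large, then by monotonicity it would exceed its average by at least
    [h - j] at each position [q + j] with [j < h]. The squares of these excesses sum to at least
    [h ^ 3 / 3], more than the discrepancy bound [2 * k ^ 3 * t ^ 2] allows. *)
Lemma select_light n (I : finType) (J : {set I}) k a h t (g : I -> 'I_t -> {set 'I_n}) :
  (0 < k)%N -> (0 < t)%N -> #|J| = t -> (h <= t)%N -> (6 * k ^ 3 * t ^ 2 < h ^ 3)%N ->
  (forall i l, i \in J -> #|g i l| = k) ->
  (forall i l, i \in J -> g i l \subset above n (a + h)) ->
  (forall i l l', i \in J -> l != l' -> [disjoint g i l & g i l']) ->
  exists c : I -> 'I_t, forall q, (a <= q)%N -> (load J (fun i => g i (c i)) q + a <= q.+1)%N.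
Proof.
move=> k0 t0 Jt ht hbig gk ga gd.
pose w i l r := #|[set z in g i l | (z <= a + r)%N]|.
(* This is [t] times the deviation of [w i l r] from its average over [l], which keeps the values
   integral. *)
pose u i l r := (t * w i l r)%:Z - (\sum_l w i l r)%N%:Z.
have wk i l r : i \in J -> (w i l r <= k)%N.
  move=> iJ; rewrite -(gk i l iJ); apply/subset_leq_card/subsetP => z.
  by rewrite inE => /andP[].
(* The range [2 * k * t] has to contain the window from [r0] to [r0 + h] used below, where
   [r0 < k * t] and [h <= t]. *)
have [||c cB] := @exists_small_discrepancy I J t (2 * k * t) u ((k * t) ^ 2)%:Z t0.
- move=> i r iJ; rewrite /u sumrB sum_constz.
  by rewrite -Posz_sum -big_distrr /= PoszM subrr.
- move=> i l r iJ; have wl := wk i l r iJ.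
  have ws : (\sum_l w i l r <= k * t)%N.
    apply: (@leq_trans (\sum_(l < t) k)); first by apply: leq_sum => l' _; apply: wk.
    by rewrite sum_nat_const card_ord mulnC.
  have wt : (t * w i l r <= k * t)%N by rewrite mulnC leq_mul2r wl orbT.
  by rewrite /u; move: (t * w i l r)%N (\sum_l _)%N (k * t)%N ws wt => x y z; nia.
exists c => q aq; rewrite leqNgt; apply/negP => ql.
set L := load J (fun i => g i (c i)) in ql.
pose r0 := (q - a)%N.
have Lk : (L q <= k * t)%N by rewrite -Jt; apply: load_le_card => i; apply: gk.
(* Some chosen edge has a vertex at most [q], and all of them lie above [a + h]. Hence
   [(r0 + j).+1 - h] below is not truncated. *)
have r0h : (h <= r0)%N.
  have : (0 < L q)%N by lia.
  rewrite lt0n sum_nat_eq0 => /forallPn[i]; rewrite negb_imply => /andP[iJ].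
  rewrite cards_eq0 => /set0Pn[z]; rewrite inE => /andP[zi zq].
  by have := subsetP (ga i _ iJ) _ zi; rewrite inE /r0; lia.
pose D r := \sum_(i in J) u i (c i) r.
have Dge j : (j < h)%N -> (t * (h - j))%:Z <= D (r0 + j)%N.
  move=> jh; have -> : D (r0 + j)%N = (t * L (a + (r0 + j)))%:Z -
      (\sum_(i in J) \sum_l w i l (r0 + j))%N%:Z.
    by rewrite /D /u sumrB -!Posz_sum -big_distrr.
  have Lm : (L q <= L (a + (r0 + j)))%N by apply: load_mono; lia.
  have Ws : (\sum_(i in J) \sum_l w i l (r0 + j) <= t * ((r0 + j).+1 - h))%N.
    rewrite -[X in (_ <= X * _)%N]Jt -sum_nat_const; apply: leq_sum => i iJ.
    have -> : ((r0 + j).+1 - h = (a + (r0 + j)).+1 - (a + h))%N by lia.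
    have -> : (\sum_l w i l (r0 + j) = load setT (g i) (a + (r0 + j)))%N.
      by apply: eq_bigl => l; rewrite inE.
    by apply: load_disjoint => [l _|l l' _ _]; [apply: ga|apply: gd].
  have : (t * (h - j) + t * ((r0 + j).+1 - h) <= t * L (a + (r0 + j)))%N.
    by rewrite -mulnDr leq_mul2l; lia.
  by rewrite lerBrDr -PoszD lez_nat; apply: leq_trans; rewrite leq_add2l.
have : ((t ^ 2) * \sum_(j < h) (h - j) ^ 2)%N%:Z <= (t * (2 * k * t))%:Z * ((k * t) ^ 2)%:Z.
  rewrite -[X in (X * (2 * k * t))%N]Jt; apply: le_trans cB.
  rewrite -(big_mkord xpredT (fun r => D r ^+ 2)) /=.
  have r0k : (r0 + h <= 2 * k * t)%N.
    by have := leq_pmull t k0; rewrite -mulnA /r0; lia.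
  rewrite (@big_cat_nat _ _ _ r0 0%N (2 * k * t)%N) //=; last first.
    by apply: leq_trans r0k; apply: leq_addr.
  rewrite (@big_cat_nat _ _ _ (r0 + h)%N r0 (2 * k * t)%N) //= ?leq_addr //.
  rewrite addrCA -[leLHS]addr0; apply: lerD; last first.
    by apply: addr_ge0; apply: sumr_ge0 => r _; apply: sqr_ge0.
  rewrite -{1}[r0]add0n big_addn addKn big_mkord.
  rewrite PoszM Posz_sum mulr_sumr; apply: ler_sum => j _.
  rewrite -PoszM -expnMn [(j + r0)%N]addnC.
  by have := Dge j (ltn_ord j); move: (t * (h - j))%N (D _) => x y; nia.
have := sum_squares_ge h; move: (\sum_(j < h) _)%N => S hS; nia.
Qed.

End Selection.

(** * Shadows *)

Definition link (T : finType) (v : T) (F : {set {set T}}) : {set {set T}} :=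
  [set e : {set T} | (v \notin e) && (v |: e \in F)].

Lemma card_link (T : finType) (v : T) (F : {set {set T}}) :
  #|link v F| = #|[set e in F | v \in e]|.
Proof.
rewrite -(@card_in_imset _ _ (fun e => v |: e)) => [|e e']; last first.
  rewrite !inE => /andP[ve _] /andP[ve' _] /setP E; apply/setP => z.
  have [->|zv] := eqVneq z v; first by rewrite (negPf ve) (negPf ve').
  by have := E z; rewrite !inE (negPf zv).
apply: eq_card => e; rewrite !inE; apply/imsetP/andP => [[d]|[eF ve]].
  by rewrite inE => /andP[_ dF] ->; rewrite dF setU11.
by exists (e :\ v); rewrite ?inE ?eqxx ?setD1K.
Qed.

Lemma card_split (T : finType) (v : T) (F : {set {set T}}) :
  #|F| = #|[set e in F | v \notin e]| + #|link v F|.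
Proof.
rewrite card_link -(cardsID [set e : {set T} | v \in e] F) addnC.
by congr (_ + _); apply: eq_card => e; rewrite !inE andbC.
Qed.

Lemma sum_card_link (T : finType) (F : {set {set T}}) :
  \sum_(e in F) #|e| = \sum_(v : T) #|link v F|.
Proof.
under [RHS]eq_bigr do rewrite card_link -sum1dep_card.
rewrite (exchange_big_dep (mem F)) /= => [|i j _ /andP[] //].
apply: eq_bigr => e eF; rewrite -sum1_card; apply: eq_bigl => v.
by rewrite eF.
Qed.

Lemma distinct_elements (T : finType) (A : {set T}) r : r <= #|A| ->
  exists f : 'I_r -> T, injective f /\ forall i, f i \in A.
Proof.
move=> rA; exists (fun i => enum_val (widen_ord rA i)); split=> [i j /enum_val_inj|i].
  by move/(congr1 val) => /= ij; apply: val_inj.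
exact: enum_valP.
Qed.

Section Shadow.
Variables (n b s : nat).
Implicit Types (F G : {set {set 'I_n}}) (e g : {set 'I_n}) (v x y z : 'I_n).

(** Double counting of pairs of an edge and one of its vertices: a set in [G] that extends to an
    edge has [k] elements, which leaves at most [c - b - k <= k.+1 * s] extensions. *)
Lemma shadow_bound_small k c F G :
  (forall e, e \in F -> #|e| = k.+1) ->
  (forall e x, e \in F -> x \in e -> b <= x < c) ->
  (forall e x, e \in F -> x \in e -> e :\ x \in G) ->
  c - b < k.+1 * s.+1 -> #|F| <= s * #|G|.
Proof.
move=> Fk Fbc FG small.
rewrite -(@leq_pmul2r k.+1) // -sum_nat_const -(eq_bigr _ Fk) sum_card_link.
have -> : \sum_v #|link v F| = \sum_v \sum_(g in link v F) 1.
  by apply: eq_bigr => v _; rewrite sum1_card.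
rewrite (exchange_big_dep (mem G)) /= => [|v g _]; last first.
  rewrite inE => /andP[vg gF]; have := FG _ _ gF (setU11 _ _).
  by rewrite setU1K.
rewrite -mulnA mulnCA -sum_nat_const; apply: leq_sum => g gG.
have [/existsP[x0]|] := boolP [exists x, g \in link x F]; last first.
  by rewrite negb_exists => /forallP ng; rewrite big_pred0 // => x; rewrite /= (negbTE (ng x)).
rewrite inE => /andP[x0g gF].
have gk : #|g| = k by have := Fk _ gF; rewrite cardsU1 x0g => -[].
have : #|[set x | g \in link x F] :|: g| <= #|[set z : 'I_n | b <= z < c]|.
  apply/subset_leq_card/subsetP => x; rewrite !inE => /orP[/andP[_ xF]|xg].
    exact: (Fbc _ _ xF (setU11 _ _)).
  by apply: (Fbc _ _ gF); rewrite inE xg orbT.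
rewrite card_interval cardsU gk.
have -> : [set x | g \in link x F] :&: g = set0.
  by apply/setP => x; rewrite !inE; case: (x \in g); rewrite ?andbF.
rewrite cards0 subn0 sum1dep_card.
have cb : minn c n - b <= c - b by lia.
by move: small cb; rewrite mulSn !mulnS; move: (minn c n - b) (c - b) #|_| => p q r; lia.
Qed.

Lemma shadow_bound_singletons F G :
  (forall e, e \in F -> #|e| = 1) ->
  (forall e x, e \in F -> x \in e -> e :\ x \in G) ->
  ~ has_rainbow_matching (fun _ : 'I_s.+1 => F) -> #|F| <= s * #|G|.
Proof.
move=> F1 FG nF; have [->|/set0Pn[e eF]] := eqVneq F set0; first by rewrite cards0.
have G0 : 0 < #|G|.
  have /set0Pn[x xe] : e != set0 by rewrite -card_gt0 F1.
  by rewrite card_gt0; apply/set0Pn; exists (e :\ x); apply: FG.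
apply: leq_trans (leq_pmulr _ G0); rewrite leqNgt; apply/negP => sF.
have [f [finj fF]] := distinct_elements sF.
apply: nF; exists f; split=> // i j ij.
have /eqP/cards1P[x fx] := F1 _ (fF i); have /eqP/cards1P[y fy] := F1 _ (fF j).
rewrite fx fy disjoints1 inE; apply: contra ij => /eqP xy.
by apply/eqP/finj; rewrite fx fy xy.
Qed.

(** Frankl's shadow theorem, by induction on [c] and splitting at the top vertex [v]. A matching of
    [s + 1] edges in the link of [v] would leave at least [s + 1] vertices of [[b, c]] free; adding
    a different one to each edge, by shifting [v], gives a matching in [F]. *)
Lemma shadow_bound k c F G :
  (forall e, e \in F -> #|e| = k.+1) ->
  (forall e x, e \in F -> x \in e -> b <= x < c) ->
  shifted b F ->
  (forall e x, e \in F -> x \in e -> e :\ x \in G) ->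
  ~ has_rainbow_matching (fun _ : 'I_s.+1 => F) -> #|F| <= s * #|G|.
Proof.
elim: c k F G => [|c IH] k F G Fk Fbc shF FG nF.
  by apply: (shadow_bound_small Fk Fbc FG); rewrite sub0n.
have [small|big] := ltnP (c.+1 - b) (k.+1 * s.+1); first exact: (shadow_bound_small Fk Fbc FG).
case: k => [|k] in Fk big *; first exact: shadow_bound_singletons.
have [cn|nc] := ltnP c n; last first.
  apply: (IH k.+1) => // e x eF xe; have /andP[-> _] := Fbc e x eF xe.
  exact: leq_trans (ltn_ord x) nc.
pose v := Ordinal cn.
have ltv e x : e \in F -> x \in e -> x != v -> b <= x < c.
  by move=> eF xe; have := Fbc e x eF xe; rewrite -val_eqE /=; lia.
have vlt x y : y < x -> x <= c -> y != v by rewrite -val_eqE /=; lia.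
rewrite (card_split v F) (card_split v G) mulnDr; apply: leq_add.
  apply: (IH k.+1).
  - by move=> e; rewrite inE => /andP[/Fk].
  - move=> e x; rewrite inE => /andP[eF ve] xe; apply: (ltv e x eF xe).
    by apply: contraNneq ve => <-.
  - move=> e x y; rewrite !inE => /andP[eF ve] xe ye bby yx.
    rewrite shF //= (negPf ve) andbF orbF eq_sym (@vlt x) //.
    by have := Fbc e x eF xe; lia.
  - by move=> e x; rewrite !inE => /andP[eF /negPf ve] xe; rewrite FG // ve andbF.
  - by move=> [f [fF fd]]; apply: nF; exists f; split=> // i; have := fF i; rewrite inE => /andP[].
apply: (IH k).
- by move=> e; rewrite inE => /andP[ve /Fk]; rewrite cardsU1 ve => -[].
- move=> e x; rewrite inE => /andP[ve eF] xe; apply: (ltv _ x eF).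
    by rewrite !inE xe orbT.
  by apply: contraNneq ve => <-.
- move=> e x y; rewrite !inE => /andP[ve eF] xe ye bby yx.
  have xv : x != v by apply: contraNneq ve => <-.
  have xb := ltv _ x eF (setU1r _ xe) xv.
  have yv : y != v by apply: (@vlt x) => //; lia.
  rewrite (negPf ve) andbF orbF eq_sym yv /=.
  have -> : v |: (y |: e :\ x) = y |: (v |: e) :\ x.
    apply/setP => z; rewrite !inE; case: (eqVneq z v) => [->|_] /=.
      by rewrite (eq_sym v x) (negPf xv) orbT.
    by [].
  by apply: shF => //; rewrite !inE ?xe ?orbT // negb_or yv.
- move=> e x; rewrite !inE => /andP[ve eF] xe.
  rewrite (negPf ve) andbF /=.
  have -> : v |: e :\ x = (v |: e) :\ x.
    apply/setP => z; rewrite !inE; case: (eqVneq z v) => [->|_] //=.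
    by rewrite andbT; apply/esym; apply: contraNneq ve => ->.
  by apply: FG; rewrite // !inE xe orbT.
- move=> [f [fF fd]]; apply: nF.
  have fk i : #|f i| = k.+1.
    by have := fF i; rewrite inE => /andP[vf /Fk]; rewrite cardsU1 vf => -[].
  have fb i x : x \in f i -> b <= x < c.
    move=> xf; have := fF i; rewrite inE => /andP[vf fvF].
    apply: (ltv _ x fvF); first by rewrite !inE xf orbT.
    by apply: contraNneq vf => <-.
  pose U := \bigcup_i f i; pose V := [set z : 'I_n | b <= z < c.+1].
  have cU : #|U| = k.+1 * s.+1.
    by rewrite -sum_card_disjoint // (eq_bigr _ (fun i _ => fk i)) sum_nat_const card_ord mulnC.
  have UV : U \subset V.
    by apply/bigcupsP => i _; apply/subsetP => x /fb; rewrite inE; lia.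
  have [|z [zinj zV]] := @distinct_elements _ (V :\: U) s.+1.
    rewrite cardsD (setIidPr UV) cU card_interval; lia.
  have zf i j : z i \notin f j.
    have := zV i; rewrite inE => /andP[zU _]; apply: contra zU => zf.
    by apply/bigcupP; exists j.
  exists (fun i => z i |: f i); split=> [i|i j ij].
    have := fF i; rewrite inE => /andP[vf fvF].
    have [->//|zv] := eqVneq (z i) v.
    have := zV i; rewrite !inE => /andP[_ /andP[bz zc]].
    have := shF _ v (z i) fvF (setU11 _ _); rewrite setU1K //; apply=> //.
      by rewrite !inE negb_or zv zf.
    by move: zv; rewrite -val_eqE /=; lia.
  rewrite disjoints_subset; apply/subsetP => x; rewrite !inE negb_or.
  case/orP => [/eqP->|xi].
    by rewrite zf andbT; apply: contra ij => /eqP/zinj/eqP.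
  by rewrite (disjointFr (fd i j ij) xi) andbT; apply: contraTneq xi => ->.
Qed.

End Shadow.

(** * Nested cross-dependent families *)

(** Greedy choice from the last set back to the first: each set has more elements than the sets
    after it have used up. *)
Lemma distinct_representatives (U : finType) s (A : nat -> {set U}) :
  (forall i, i <= s -> s.+1 - i <= #|A i|) ->
  exists f : 'I_s.+1 -> U, injective f /\ forall i, f i \in A i.
Proof.
elim: s A => [|s IH] A HA.
  have /card_gt0P[x xA] : 0 < #|A 0| by apply: (HA 0).
  by exists (fun=> x); split=> [i j _|i]; rewrite ?(ord1 i) ?(ord1 j).
have [i si|f [finj fA]] := IH (fun i => A i.+1); first by have := HA i.+1 si; rewrite subSS.
have : ~~ (A 0 \subset f @: [set: 'I_s.+1]).
  apply/negP => /subset_leq_card; rewrite card_imset // cardsT card_ord.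
  by have := HA 0 isT; lia.
case/subsetPn => x xA xf.
exists (fun i => if unlift ord0 i is Some l then f l else x); split=> [i i'|i].
  case: (unliftP ord0 i) => [l|] ->; case: (unliftP ord0 i') => [l'|] -> //.
  - by move/finj ->.
  - by move=> E; case/negP: xf; rewrite -E imset_f.
  - by move=> E; case/negP: xf; rewrite E imset_f.
by case: (unliftP ord0 i) => [l|] ->; [exact: fA|].
Qed.

(** * Averaging over packings of disjoint [j]-sets *)

Section Averaging.
Variables (T : finType) (Y : {set T}) (j N : nat).
Implicit Types (B : {set T}) (M G : {set {set T}}).

Definition packings : {set {set {set T}}} :=
  [set M | [&& trivIset M, #|M| == N & [forall B in M, (B \subset Y) && (#|B| == j)]]].

Lemma packingsP M : reflect
  [/\ trivIset M, #|M| = N & forall B, B \in M -> B \subset Y /\ #|B| = j] (M \in packings).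
Proof.
rewrite inE; apply: (iffP and3P) => [[tM /eqP cM /forallP HM]|[tM cM HM]]; split=> //.
- by move=> B BM; have := HM B; rewrite BM => /andP[-> /eqP].
- exact/eqP.
- by apply/forallP => B; apply/implyP => /HM[-> ->] /=.
Qed.

Lemma tperm_packings x y M : x \in Y -> y \in Y -> M \in packings ->
  (fun B => tperm x y @: B) @: M \in packings.
Proof.
move=> xY yY /packingsP[tM cM HM]; apply/packingsP; split.
- apply/trivIsetP => _ _ /imsetP[B BM ->] /imsetP[C CM ->] BC.
  rewrite imset_disjoint; last exact: perm_inj.
  apply: (trivIsetP tM) => //; apply: contraNneq BC => E.
  by rewrite E.
- by rewrite (card_imset _ (@tperm_imset_inj _ x y)).
- move=> _ /imsetP[B /HM[/subsetP BY BJ] ->]; rewrite card_imset; last exact: perm_inj.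
  split=> //; apply/subsetP => _ /imsetP[z zB ->].
  by case: tpermP => // _ _; apply: BY.
Qed.

Lemma packings_through_le x y B : x \in Y -> y \in Y ->
  #|[set M in packings | B \in M]| <= #|[set M in packings | tperm x y @: B \in M]|.
Proof.
move=> xY yY; pose f M := (fun B => tperm x y @: B) @: M.
have finj : injective f := imset_inj (@tperm_imset_inj _ x y).
rewrite -(card_imset _ finj); apply/subset_leq_card/subsetP => _ /imsetP[M MB ->].
move: MB => /setIdP[MP BM]; apply/setIdP; split; first exact: tperm_packings.
by apply/imsetP; exists B.
Qed.

(** Transpositions of [Y] permute the packings, and [B] is carried to [B'] by exchanging one element
    at a time. Equality follows by symmetry. *)
Lemma packings_through_const B B' : B \subset Y -> B' \subset Y -> #|B| = #|B'| ->
  #|[set M in packings | B \in M]| <= #|[set M in packings | B' \in M]|.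
Proof.
have [w] := ubnP #|B :\: B'|; elim: w B => // w IH B /ltnSE Bw BY B'Y cB.
have [BB'|/subsetPn[x xB xB']] := boolP (B \subset B').
  suff -> : B = B' by [].
  by apply/eqP; rewrite eqEcard BB' cB /=.
have /subsetPn[y yB' yB] : ~~ (B' \subset B).
  apply: contra xB' => B'B; suff -> : B' = B by [].
  by apply/eqP; rewrite eqEcard B'B cB /=.
have xY := subsetP BY _ xB; have yY := subsetP B'Y _ yB'.
apply: leq_trans (packings_through_le B xY yY) _.
apply: IH => //.
- rewrite tperm_imset //; apply: leq_trans Bw; apply: proper_card.
  apply/properP; split; last by exists x; rewrite !inE ?xB ?xB' // eqxx /= orbF;
    apply: contraNneq xB' => ->.
  apply/subsetP => z; rewrite !inE; case: eqP => [->|_] /=; first by rewrite yB'.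
  by case/and3P=> -> _ ->.
- by apply/subsetP => _ /imsetP[z zB ->]; case: tpermP => // _ _; apply: (subsetP BY).
- by rewrite card_imset //; apply: perm_inj.
Qed.

Lemma sum_card_packings G :
  \sum_(M in packings) #|M :&: G| = \sum_(B in G) #|[set M in packings | B \in M]|.
Proof.
under eq_bigr do rewrite -sum1_card.
rewrite (exchange_big_dep (mem G)) /= => [|M B _]; last by rewrite inE => /andP[].
apply: eq_bigr => B BG; rewrite -sum1dep_card; apply: eq_bigl => M.
by rewrite in_setI BG andbT.
Qed.

Lemma exists_packing : 0 < j -> N * j <= #|Y| -> packings != set0.
Proof.
move=> j0 NY.
suff [M [tM cM HM]] : exists M, [/\ trivIset M, #|M| = N &
    forall B, B \in M -> B \subset Y /\ #|B| = j].
  by apply/set0Pn; exists M; apply/packingsP.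
elim: N NY => [|N' IH] NY.
  exists set0; split=> [||B]; rewrite ?cards0 ?inE //.
  by apply/trivIsetP => B C; rewrite inE.
have [|M [tM cM HM]] := IH; first by apply: leq_trans NY; rewrite leq_mul2r leqnSn orbT.
have cV : #|cover M| = N' * j.
  rewrite -(eqP tM) -cM -sum_nat_const; apply: eq_bigr => B /HM[] //.
have VY : cover M \subset Y by apply/bigcupsP => B /HM[].
have : 0 < #|[set B : {set T} | B \subset Y :\: cover M & #|B| == j]|.
  rewrite cards_draws bin_gt0 cardsD (setIidPr VY) cV; move: NY; rewrite mulSn; lia.
case/card_gt0P => B; rewrite inE subsetD => /andP[/andP[BY BV] /eqP Bj].
have dis C : C \in M -> [disjoint B & C].
  by move=> CM; apply: disjointWr BV; apply: bigcup_max (subxx C).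
have BM : B \notin M.
  apply/negP => /dis; rewrite -setI_eq0 setIid => /eqP B0.
  by rewrite -Bj B0 cards0 in j0.
exists (B |: M); split.
- apply/trivIsetP => C D; rewrite !inE => /orP[/eqP->|CM] /orP[/eqP->|DM] CD.
  + by rewrite eqxx in CD.
  + exact: dis.
  + by rewrite disjoint_sym dis.
  + exact: (trivIsetP tM).
- by rewrite cardsU1 BM cM.
- by move=> C; rewrite !inE => /orP[/eqP->|/HM].
Qed.

Lemma packings_uniform : 0 < j -> N * j <= #|Y| ->
  exists c, forall G, (forall B, B \in G -> B \subset Y /\ #|B| = j) ->
    \sum_(M in packings) #|M :&: G| = c * #|G|.
Proof.
move=> j0 NY.
have [/existsP[B0 /andP[B0Y /eqP B0j]]|] :=
    boolP [exists B : {set T}, (B \subset Y) && (#|B| == j)].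
  exists #|[set M in packings | B0 \in M]| => G HG.
  rewrite sum_card_packings mulnC -sum_nat_const; apply: eq_bigr => B /HG[BY Bj].
  by apply/eqP; rewrite eqn_leq !packings_through_const // Bj B0j.
rewrite negb_exists => /forallP nB; exists 0 => G HG.
have -> : G = set0.
  apply/setP => B; rewrite inE; apply/negP => /HG[BY Bj].
  by have := nB B; rewrite BY Bj eqxx.
by rewrite big1 // => M _; rewrite setI0 cards0.
Qed.

Variables (s : nat) (G : nat -> {set {set T}}).
Hypothesis G_nested : forall i i', i <= i' <= s -> G i' \subset G i.
Hypothesis G_cross : ~ exists f : 'I_s.+1 -> {set T},
  (forall i, f i \in G i) /\ (forall i i', i != i' -> [disjoint f i & f i']).

(* By Hall's condition for nested sets, some [G p] contains at most [s - p] members of [M].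
   Using [#|M :&: G 0|] rather than [N] as the bound for the first [p] degrees keeps the
   slack [N - (2 * s + 1)] available when [G 0] is far from complete. *)
Lemma packing_inequality M : M \in packings -> 2 * s + 1 <= N ->
  N * (\sum_(i < s) #|M :&: G i| + s.+1 * #|M :&: G s|) <=
  s * ((2 * s + 1) * N + #|M :&: G 0| * (N - (2 * s + 1))).
Proof.
move=> /packingsP[tM cM HM] sN; pose d i := #|M :&: G i|.
have dmono i i' : i <= i' <= s -> d i' <= d i.
  by move=> /G_nested Gi; apply/subset_leq_card/setIS.
have d0N : d 0 <= N by rewrite -cM; apply/subset_leq_card/subsetIl.
have [p [ps dp]] : exists p, p <= s /\ d p <= s - p.
  have [/existsP[p dp]|] := boolP [exists p : 'I_s.+1, d p <= s - p].
    by exists p; rewrite -ltnS ltn_ord.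
  rewrite negb_exists => /forallP nd; case: G_cross.
  have [i si|f [finj fM]] := @distinct_representatives _ s (fun i => M :&: G i).
    by have := nd (Ordinal (si : i < s.+1)); rewrite -ltnNge /= subSn.
  exists f; split=> [i|i i' ii'].
    by have := fM i; rewrite inE => /andP[].
  have := fM i; have := fM i'; rewrite !inE => /andP[fi' _] /andP[fi _].
  by apply: (trivIsetP tM) => //; apply: contraNneq ii' => /finj ->.
have sumd : \sum_(i < s) d i <= p * d 0 + (s - p) * (s - p).
  rewrite -(big_mkord xpredT) (@big_cat_nat _ _ _ p) //=; apply: leq_add.
    apply: (@leq_trans (\sum_(0 <= i < p) d 0)); last by rewrite sum_nat_const_nat subn0.
    by rewrite big_nat [leqRHS]big_nat; apply: leq_sum => i ip; apply: dmono; lia.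
  apply: (@leq_trans (\sum_(p <= i < s) (s - p))); last by rewrite sum_nat_const_nat.
  rewrite big_nat [leqRHS]big_nat; apply: leq_sum => i ip.
  by apply: leq_trans dp; apply: dmono; lia.
have ds : d s <= s - p by apply: leq_trans dp; apply: dmono; rewrite ps leqnn.
apply: (@leq_trans (N * (p * d 0 + (s - p) * (s - p) + s.+1 * (s - p)))).
  by rewrite leq_mul2l leq_add ?orbT // leq_mul2l ds orbT.
rewrite -/(d 0); move: (d 0) d0N {sumd ds dp dmono cM} => d0 d0N.
set w := N - (2 * s + 1); set q := s - p.
have -> : N * (p * d0 + q * q + s.+1 * q) = p * d0 * N + q * (q + s.+1) * N by nia.
have [small|big] := leqP d0 (2 * s + 1).
  have h1 : p * d0 * N <= p * (2 * s + 1) * N by rewrite leq_mul2r leq_mul2l small !orbT.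
  have h2 : q * (q + s.+1) * N <= q * (2 * s + 1) * N.
    by rewrite leq_mul2r leq_mul2l; apply/orP; right; apply/orP; right; rewrite /q; lia.
  have -> : s * ((2 * s + 1) * N + d0 * w) =
      p * (2 * s + 1) * N + q * (2 * s + 1) * N + s * (d0 * w).
    rewrite mulnDr; congr (_ + _); rewrite -!mulnA -mulnDl; congr (_ * _); rewrite /q; lia.
  by apply: (leq_trans (leq_add h1 h2)); apply: leq_addr.
have h2 : q * (q + s.+1) * N <= q * (2 * s + 1) * N.
  by rewrite leq_mul2r leq_mul2l; apply/orP; right; apply/orP; right; rewrite /q; lia.
(* Split [N] as [2 * s + 1 + w] and use [d0 <= N] in the first part only. *)
have h1 : d0 * N <= (2 * s + 1) * N + d0 * w.
  have -> : N = 2 * s + 1 + w by rewrite /w; lia.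
  have : d0 <= 2 * s + 1 + w by rewrite /w; lia.
  by move: (2 * s + 1) => a; nia.
have h1p : p * (d0 * N) <= p * ((2 * s + 1) * N + d0 * w) by rewrite leq_mul2l h1 orbT.
have -> : s = p + q by rewrite /q; lia.
rewrite mulnDl -mulnA; apply: leq_add; first by move: h1p; rewrite /q subnKC.
apply: leq_trans (leq_trans h2 _); first by rewrite /q subnKC.
by rewrite -mulnA leq_mul2l; apply/orP; right; rewrite /q subnKC // leq_addr.
Qed.

(** [packing_inequality] is summed over all packings. Every degree then turns into [c] times the
    size of its family, and [N] into [c] times the number of all [j]-sets, so [c] cancels. *)
Lemma cross_dependent_sum_bound : 0 < j -> N * j <= #|Y| -> 2 * s + 1 <= N ->
  (forall i B, i <= s -> B \in G i -> B \subset Y /\ #|B| = j) ->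
  N * (\sum_(i < s) #|G i| + s.+1 * #|G s|) <=
  s * ((2 * s + 1) * 'C(#|Y|, j) + #|G 0| * (N - (2 * s + 1))).
Proof.
move=> j0 NY sN GY; have [c cG] := packings_uniform j0 NY.
have cC : #|packings| * N = c * 'C(#|Y|, j).
  rewrite -cards_draws -cG; last by move=> B; rewrite inE => /andP[-> /eqP].
  rewrite -sum_nat_const; apply: eq_bigr => M /packingsP[_ <- HM]; congr #|pred_of_set _|.
  apply/esym/setIidPl/subsetP => B /HM[BY Bj]; by rewrite inE BY Bj eqxx.
have c0 : 0 < c.
  have : 0 < #|packings| * N by rewrite muln_gt0 card_gt0 exists_packing //; lia.
  by rewrite cC muln_gt0 => /andP[].
rewrite -(leq_pmul2l c0).
have sumG i : i <= s -> \sum_(M in packings) #|M :&: G i| = c * #|G i|.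
  by move=> si; apply: cG => B; apply: GY.
have : \sum_(M in packings) N * (\sum_(i < s) #|M :&: G i| + s.+1 * #|M :&: G s|) <=
    \sum_(M in packings) s * ((2 * s + 1) * N + #|M :&: G 0| * (N - (2 * s + 1))).
  by apply: leq_sum => M MP; apply: packing_inequality.
rewrite -!big_distrr /= !big_split /= -big_distrr exchange_big /=.
rewrite -[X in _ <= s * (_ + X)]big_distrl /=.
rewrite (sumG s) // (sumG 0) // sum_nat_const.
rewrite (eq_bigr (fun i : 'I_s => c * #|G i|)) => [|i _]; last exact/sumG/ltnW.
rewrite -big_distrr /= [#|_| * _]mulnCA cC.
have -> : N * (c * \sum_(i < s) #|G i| + s.+1 * (c * #|G s|)) =
    c * (N * (\sum_(i < s) #|G i| + s.+1 * #|G s|)) by ring.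
suff -> : s * ((2 * s + 1) * (c * 'C(#|Y|, j)) + c * #|G 0| * (N - (2 * s + 1))) =
    c * (s * ((2 * s + 1) * 'C(#|Y|, j) + #|G 0| * (N - (2 * s + 1)))) by [].
by ring.
Qed.

End Averaging.

(** * Matching-free shifted families *)

Lemma notin_subset (T : finType) (A B : {set T}) x : A \subset B -> x \notin B -> x \notin A.
Proof. by move/subsetP => AB; apply: contra; apply: AB. Qed.

Section Frankl.
Variables (n b s k : nat).
Hypothesis bsn : b + s < n.
Implicit Types (F : {set {set 'I_n}}) (e B : {set 'I_n}) (v x y z : 'I_n).

Let High := above n (b + s.+1).
Let Low := above n b :\: High.

(** Unlike [link], this admits only sets avoiding all of [Low], so distinct vertices of [Low]
    account for distinct edges. *)
Definition upper_link v F : {set {set 'I_n}} :=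
  [set B : {set 'I_n} | (B \subset High) && (v |: B \in F)].

(** The default [Ordinal bsn] makes this total; it is not reached for [i <= s]. *)
Definition nth_vertex (i : nat) : 'I_n := insubd (Ordinal bsn) (b + i).

Lemma nth_vertexE i : i <= s -> nth_vertex i = b + i :> nat.
Proof. by move=> si; rewrite insubdK //; move: bsn; rewrite unfold_in /=; lia. Qed.

Lemma nth_vertex_inj : injective (fun i : 'I_s.+1 => nth_vertex i).
Proof.
move=> i i' /(congr1 (@nat_of_ord n)); rewrite !nth_vertexE ?leq_ord //.
by move/addnI; apply: val_inj.
Qed.

Lemma mem_Low v : (v \in Low) = (b <= v <= b + s).
Proof. by rewrite !inE -ltnNge addnS ltnS andbC. Qed.

Lemma nth_vertex_Low i : i <= s -> nth_vertex i \in Low.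
Proof. by move=> si; rewrite mem_Low nth_vertexE // leq_addr leq_add2l. Qed.

Lemma Low_vertices : Low = (fun i : 'I_s.+1 => nth_vertex i) @: [set: 'I_s.+1].
Proof.
apply/setP => v; rewrite mem_Low; apply/idP/imsetP => [vR|[i _ ->]]; last first.
  by rewrite nth_vertexE ?leq_ord //; have := ltn_ord i; lia.
have vs : v - b < s.+1 by lia.
by exists (Ordinal vs) => //; apply: val_inj; rewrite /= nth_vertexE; lia.
Qed.

Lemma card_High : #|High| = n - (b + s.+1).
Proof. exact: card_above. Qed.

Lemma card_upper_link F v : v \in Low -> (forall e, e \in F -> e \subset above n b) ->
  #|upper_link v F| = #|[set e in F | e :&: Low == [set v]]|.
Proof.
move=> vR Fb; have vY : v \notin High by move: vR; rewrite inE => /andP[].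
have BR B : B \subset High -> B :&: Low = set0.
  move=> /subsetP BY; apply/setP => z; rewrite in_setI in_set0.
  by apply/negP => /andP[/BY zY]; rewrite inE zY.
rewrite -(@card_in_imset _ _ (fun B => v |: B)) => [|B B']; last first.
  rewrite !in_set => /andP[BY _] /andP[BY' _] /setP E; apply/setP => z.
  have [->|zv] := eqVneq z v; last by have := E z; rewrite !inE (negPf zv).
  by rewrite !(negPf (notin_subset _ vY)).
apply: eq_card => e; apply/imsetP/setIdP => [[B]|[eF /eqP eR]].
  rewrite inE => /andP[BY vB] ->; split=> //.
  by rewrite setIUl (BR _ BY) setU0; apply/eqP/setIidPl; rewrite sub1set.
have ve : v \in e by have := set11 v; rewrite -eR inE => /andP[].
exists (e :\ v); rewrite ?inE ?setD1K // eF andbT; apply/subsetP => z.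
rewrite inE in_set1 => /andP[zv ze]; apply: contraNT zv => zY.
have : z \in e :&: Low by rewrite in_setI ze in_setD zY (subsetP (Fb _ eF)).
by rewrite eR inE.
Qed.

Lemma sum_upper_link F : (forall e, e \in F -> e \subset above n b) ->
  \sum_(i < s.+1) #|upper_link (nth_vertex i) F| = #|[set e in F | #|e :&: Low| == 1]|.
Proof.
move=> Fb; transitivity (\sum_(v in Low) #|upper_link v F|).
  rewrite Low_vertices big_imset /=; last by move=> i i' _ _ /nth_vertex_inj.
  by apply: eq_bigl => i; rewrite inE.
under eq_bigr => v vR do rewrite (card_upper_link vR Fb) -sum1dep_card.
rewrite (exchange_big_dep (fun e => (e \in F) && (#|e :&: Low| == 1))) /=; last first.
  by move=> v e _ /andP[-> /eqP->]; rewrite cards1.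
rewrite -sum1dep_card; apply: eq_bigr => e /andP[eF /cards1P[v eR]].
rewrite (big_pred1 v) // => w; rewrite eF eR /= andbC eq_sym (inj_eq set1_inj).
apply/idP/eqP => [/andP[/eqP]//|->]; rewrite eqxx.
by have := set11 v; rewrite -eR inE => /andP[].
Qed.

Lemma upper_link_ksubsets v F : v \in Low -> (forall e, e \in F -> #|e| = k.+1) ->
  forall B, B \in upper_link v F -> B \subset High /\ #|B| = k.
Proof.
move=> vR Fk B; rewrite inE => /andP[BY /Fk]; rewrite cardsU1.
have -> : v \notin B.
  by move: vR; rewrite inE => /andP[vY _]; apply: notin_subset vY.
by case.
Qed.

Definition subsets_above (c l : nat) : {set {set 'I_n}} :=
  [set e : {set 'I_n} | (e \subset above n c) && (#|e| == l)].

Lemma card_subsets_above c l : #|subsets_above c l| = 'C(n - c, l).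
Proof. by rewrite cards_draws card_above. Qed.

(** Edges are sorted by their number of vertices in [Low]: none and one are counted exactly, and
    those with two or more are bounded by all such sets. *)
Lemma card_by_trace F : (forall e, e \in F -> e \in subsets_above b k.+1) ->
  #|F| + 'C(n - (b + s.+1), k.+1) + s.+1 * 'C(n - (b + s.+1), k) <=
  'C(n - b, k.+1) + #|[set e in F | e \subset High]| +
  \sum_(i < s.+1) #|upper_link (nth_vertex i) F|.
Proof.
move=> Fb; have Fb' e : e \in F -> e \subset above n b.
  by move=> /Fb; rewrite inE => /andP[].
pose K := subsets_above b k.+1.
have Kb e : e \in K -> e \subset above n b by rewrite inE => /andP[].
have YR e : e \subset above n b -> (e \subset High) = (#|e :&: Low| == 0).
  move=> eb; rewrite cards_eq0 setIDA (setIidPl eb) setD_eq0 //.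
have K0 : #|[set e in K | #|e :&: Low| == 0]| = 'C(n - (b + s.+1), k.+1).
  rewrite -card_subsets_above; apply: eq_card => e; apply/setIdP/setIdP => [[eK]|[eY ek]].
    by rewrite -YR ?Kb // => ->; move: eK; rewrite inE => /andP[].
  have eb : e \subset above n b.
    by apply: subset_trans eY _; apply/subsetP => z; rewrite !inE; lia.
  by rewrite inE eb ek -YR.
have K1 : #|[set e in K | #|e :&: Low| == 1]| = s.+1 * 'C(n - (b + s.+1), k).
  rewrite -sum_upper_link // -[X in X * _]card_ord -sum_nat_const; apply: eq_bigr => i _.
  rewrite -card_subsets_above; apply: eq_card => B; rewrite !inE.
  have iR : nth_vertex i \in Low by apply/nth_vertex_Low/leq_ord.
  move: (iR); rewrite mem_Low => /andP[bi _]; move: iR; rewrite inE => /andP[iY _].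
  apply/idP/idP => [/and3P[BY _]|/andP[BY /eqP Bk]]; rewrite BY /=.
    by rewrite cardsU1 (notin_subset BY iY).
  rewrite cardsU1 (notin_subset BY iY) Bk eqxx andbT subUset sub1set inE bi /=.
  by apply: subset_trans BY _; apply/subsetP => z; rewrite !inE; lia.
rewrite -K0 -K1 -(card_subsets_above b) -/K sum_upper_link //.
have -> : [set e in F | e \subset High] = [set e in F | #|e :&: Low| == 0].
  by apply/setP => e; apply/setIdP/setIdP => -[eF]; rewrite YR ?Fb'.
have split3 (H : {set {set 'I_n}}) : #|H| = #|[set e in H | #|e :&: Low| == 0]| +
    #|[set e in H | #|e :&: Low| == 1]| + #|[set e in H | 1 < #|e :&: Low|]|.
  rewrite -!sum1dep_card -sum1_card (bigID (fun e => #|e :&: Low| == 0)) /= -addnA; congr (_ + _).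
  rewrite (bigID (fun e => #|e :&: Low| == 1)) /=; congr (_ + _); apply: eq_bigl => e.
    by rewrite -andbA; congr (_ && _); case: #|_| => [|[]].
  by rewrite -andbA; congr (_ && _); case: #|_| => [|[]].
have F2 : #|[set e in F | 1 < #|e :&: Low|]| <= #|[set e in K | 1 < #|e :&: Low|]|.
  by apply/subset_leq_card/subsetP => e /setIdP[/Fb eK e2]; apply/setIdP.
have := split3 F; have := split3 K; lia.
Qed.

(* Frankl's proof of the Erdos matching conjecture for [n > 2 k t]: the links of the
   [s + 1] lowest vertices are nested and cross-dependent, and the edges above these
   vertices are controlled by their shadow, which lies in the smallest of the links.
   The last summand on the left is what is gained when the link of the lowest vertex
   misses all the [k]-sets above [c]. *)
Lemma matching_free_bound F N c : 0 < k ->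
  (forall e, e \in F -> e \in subsets_above b k.+1) -> shifted b F ->
  ~ has_rainbow_matching (fun _ : 'I_s.+1 => F) ->
  N * k <= n - (b + s.+1) -> 2 * s + 1 <= N ->
  b + s.+1 <= c ->
  (forall v B, v = b :> nat -> B \subset above n c -> v |: B \notin F) ->
  N * (#|F| + 'C(n - (b + s), k.+1)) + s * 'C(n - c, k) * (N - (2 * s + 1)) <=
  N * 'C(n - b, k.+1).
Proof.
move=> k0 Fb shF nF NY sN bc blocked.
have Fk e : e \in F -> #|e| = k.+1 by move/Fb; rewrite inE => /andP[_ /eqP].
pose G i := upper_link (nth_vertex i) F.
have vY i B : i <= s -> B \subset High -> nth_vertex i \notin B.
  by move=> /nth_vertex_Low; rewrite inE => /andP[vY _] BY; apply: notin_subset vY.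
have GY i B : i <= s -> B \in G i -> B \subset High /\ #|B| = k.
  by move=> /nth_vertex_Low si; apply: upper_link_ksubsets.
have nested i i' : i <= i' <= s -> G i' \subset G i.
  rewrite leq_eqVlt => /andP[/predU1P[->//|ii'] i's]; apply/subsetP => B /setIdP[BY vB].
  apply/setIdP; split=> //.
  have is_ : i <= s by lia.
  have := @shF _ (nth_vertex i') (nth_vertex i) vB (setU11 _ _).
  rewrite setU1K ?(vY i') // => H; apply: H.
  - by rewrite !inE negb_or vY // andbT -val_eqE /= !nth_vertexE //; lia.
  - by rewrite nth_vertexE // leq_addr.
  - by rewrite !nth_vertexE // ltn_add2l.
have cross : ~ exists f : 'I_s.+1 -> {set 'I_n},
    (forall i, f i \in G i) /\ (forall i i', i != i' -> [disjoint f i & f i']).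
  move=> [f [fG fd]]; apply: nF; exists (fun i : 'I_s.+1 => nth_vertex i |: f i).
  split=> [i|i i' ii'].
    by have /setIdP[] := fG i.
  have fY l : f l \subset High by have /setIdP[] := fG l.
  rewrite disjoints_subset; apply/subsetP => x; rewrite !inE negb_or.
  case/orP => [/eqP->|xi].
    rewrite vY ?leq_ord ?andbT //; apply: contra ii' => /eqP.
    by move/(@nth_vertex_inj i i') => ->.
  rewrite (disjointFr (fd i i' ii') xi) andbT; apply: contraTneq xi => ->.
  by rewrite vY // -ltnS.
have F0 : #|[set e in F | e \subset High]| <= s * #|G s|.
  apply: (@shadow_bound n (b + s.+1) s k n).
  - by move=> e /setIdP[/Fk].
  - by move=> e x /setIdP[_ /subsetP eY] /eY; rewrite inE ltn_ord => ->.
  - move=> e x y /setIdP[eF eY] xe ye bby yx; apply/setIdP; split.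
      by apply: shF => //; lia.
    by rewrite subUset sub1set inE bby /=; apply: subset_trans eY; apply: subD1set.
  - move=> e x /setIdP[eF eY] xe; rewrite inE; apply/andP; split.
      by apply: subset_trans eY; apply: subD1set.
    apply: shF => //; rewrite ?nth_vertexE ?leq_addr ?vY //.
    by have := subsetP eY _ xe; rewrite inE; lia.
  - move=> [f [fF fd]]; apply: nF; exists f; split=> // i.
    by have /setIdP[] := fF i.
have := card_by_trace Fb; rewrite big_ord_recr /= -/(G s).
have := @cross_dependent_sum_bound _ High k N s G nested cross k0.
rewrite card_High => /(_ NY sN GY).
have G0 : #|G 0| + 'C(n - c, k) <= 'C(n - (b + s.+1), k).
  rewrite -!card_subsets_above -cardsUI.
  have -> : G 0 :&: subsets_above c k = set0.
    apply/setP => B; rewrite in_set0; apply/negP => /setIP[/setIdP[_ vB] /setIdP[Bc _]].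
    by have := blocked (nth_vertex 0) B; rewrite nth_vertexE // addn0 vB => /(_ erefl Bc).
  rewrite cards0 addn0; apply/subset_leq_card/subsetP => B /setUP[/(GY 0 B isT)[BY <-]|].
    by rewrite inE BY eqxx.
  rewrite !inE => /andP[Bc ->]; rewrite andbT; apply: subset_trans Bc _.
  by apply/subsetP => z; rewrite !inE; lia.
have -> : 'C(n - (b + s), k.+1) = 'C(n - (b + s.+1), k.+1) + 'C(n - (b + s.+1), k).
  by rewrite -binS; congr 'C(_, _); lia.
have -> : \sum_(i < s) #|upper_link (nth_vertex i) F| = \sum_(i < s) #|G i| by [].
move: F0 G0; move: #|_| #|G 0| #|G s| => f0 g0 gs.
move: (\sum_(i < s) _) #|F| => X f.
move: ('C(n - (b + s.+1), k.+1)) ('C(n - (b + s.+1), k)) ('C(n - c, k)) ('C(n - b, k.+1)).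
move=> C1 C0 bb Cn F0 G0 HX Hcount.
have [w Nw] : exists w, N = 2 * s + 1 + w by exists (N - (2 * s + 1)); lia.
have wE : N - (2 * s + 1) = w by lia.
rewrite wE in HX *.
(* With [h1], the right side of [HX] plus [s * bb * w] is at most [s * C0 * N]. This cancels all but
   one of the [s.+1] copies of [C0] in [h2], and [s * bb * w] remains as the gain. *)
have h1 : s * (g0 + bb) * w <= s * C0 * w by rewrite leq_mul2r leq_mul2l G0 !orbT.
have h2 : N * (f + C1 + s.+1 * C0) <= N * (Cn + s * gs + (X + gs)).
  by rewrite leq_mul2l; lia.
move: HX h1 h2; rewrite Nw; nia.
Qed.

End Frankl.

(** * Blocked families *)

Lemma rainbow_matching_dec n t (F : 'I_t -> {set {set 'I_n}}) :
  has_rainbow_matching F \/ ~ has_rainbow_matching F.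
Proof.
have [/existsP[f /andP[/forallP fF /forallP fd]]|] := boolP [exists f : {ffun 'I_t -> {set 'I_n}},
    [forall i, f i \in F i] && [forall i, forall j, (i != j) ==> [disjoint f i & f j]]].
  left; exists f; split=> // i j ij.
  by have /forallP/(_ j)/implyP/(_ ij) := fd i.
rewrite negb_exists => /forallP nf; right => -[f [fF fd]].
have := nf [ffun i => f i]; rewrite negb_and => /orP[|] /negP; apply.
  by apply/forallP => i; rewrite ffunE.
by apply/forallP => i; apply/forallP => j; rewrite !ffunE; apply/implyP/fd.
Qed.

(** Comparison of the falling factorials factor by factor, with [M - i <= 4 * (M' - i)]. *)
Lemma bin_ratio M M' j : M <= 4 * (M' - j) -> 'C(M, j) <= 4 ^ j * 'C(M', j).
Proof.
move=> MM'; rewrite -(@leq_pmul2r j`!) ?fact_gt0 // -mulnA !bin_ffact.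
have : forall i, i <= j -> M ^_ i <= 4 ^ i * M' ^_ i.
  elim=> [|i IH] ij; first by rewrite !ffactn0.
  rewrite !ffactnSr expnS.
  have -> : 4 * 4 ^ i * (M' ^_ i * (M' - i)) = (4 ^ i * M' ^_ i) * (4 * (M' - i)) by ring.
  by apply: leq_mul; [apply: IH; lia | lia].
exact.
Qed.

Lemma bin_increment M h k : 'C(M + h, k.+1) <= 'C(M, k.+1) + h * 'C(M + h, k).
Proof.
elim: h => [|h IH]; first by rewrite addn0 mul0n addn0.
rewrite addnS binS.
have h1 : 'C(M + h, k) <= 'C((M + h).+1, k) by apply: leq_bin2l.
have h2 : h * 'C(M + h, k) <= h * 'C((M + h).+1, k) by rewrite leq_mul2l h1 orbT.
rewrite mulSn; lia.
Qed.

Section Blocked.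
Variables (n a k s : nat).
Implicit Types (F : {set {set 'I_n}}) (e B : {set 'I_n}) (v x y z : 'I_n).

(* If an edge through [a] has its other vertices above [a + k * s], then it is disjoint
   from any matching of [s] edges that has been pushed down to the vertices
   [a + 1, ..., a + k * s]. *)
Definition blocked F := forall v B, v = a :> nat ->
  B \subset above n (a + 1 + k * s) -> v |: B \notin F.

(** Otherwise one vertex of [e] can be shifted to [a], or is [a] already, while all others lie above
    [a + k * s]; this is what [blocked] excludes. *)
Lemma blocked_two_low F e : 0 < k -> shifted 0 F -> (forall e, e \in F -> #|e| = k) ->
  blocked F -> e \in F -> e \subset above n a ->
  1 < #|e :&: [set z : 'I_n | a <= z < a + 1 + k * s]|.
Proof.
move=> k0 shF Fk bF eF ea; set R := [set z : 'I_n | _]; rewrite ltnNge; apply/negP => eR.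
have [x xe xR] : exists2 x, x \in e & e :\ x \subset above n (a + 1 + k * s).
  have low z : z \in e -> z \notin R -> z \in above n (a + 1 + k * s).
    by move=> /(subsetP ea); rewrite !inE; lia.
  have [eR0|/set0Pn[x xeR]] := eqVneq (e :&: R) set0.
    have /card_gt0P[x xe] : 0 < #|e| by rewrite Fk.
    exists x => //; apply/subsetP => z /setD1P[_ ze]; apply: low => //.
    by apply/negP => zR; have := in_set0 z; rewrite -eR0 inE ze zR.
  move: (xeR) => /setIP[xe xR]; exists x => //; apply/subsetP => z /setD1P[zx ze].
  apply: low => //; apply/negP => zR; case/negP: zx.
  have /cards1P[w ew] : #|e :&: R| == 1.
    by rewrite eqn_leq eR; apply/card_gt0P; exists x.
  have : z \in e :&: R by rewrite inE ze zR.
  by move: xeR; rewrite ew !inE => /eqP-> .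
have ax : a <= x by have := subsetP ea _ xe; rewrite inE.
have an : a < n by apply: leq_ltn_trans ax (ltn_ord x).
have [xa|xa] := eqVneq (x : nat) a.
  by have := bF x (e :\ x) xa xR; rewrite setD1K ?eF.
have [ae|ae] := boolP (Ordinal an \in e).
  have : Ordinal an \in e :\ x by rewrite !inE ae -val_eqE /= eq_sym xa.
  by move/(subsetP xR); rewrite inE /=; lia.
have := bF (Ordinal an) (e :\ x) erefl xR.
by rewrite shF //= ltn_neqAle eq_sym xa.
Qed.

(** An edge is encoded by two of its low vertices together with its remaining [k - 2] vertices. *)
Lemma blocked_card F : 0 < k -> shifted 0 F -> (forall e, e \in F -> #|e| = k) -> blocked F ->
  #|[set e in F | e \subset above n a]| <= 'C(k * s + 1, 2) * 'C(n - a, k - 2).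
Proof.
move=> k0 shF Fk bF; set R := [set z : 'I_n | a <= z < a + 1 + k * s].
pose P := [set A : {set 'I_n} | A \subset R & #|A| == 2].
have cP : #|P| <= 'C(k * s + 1, 2).
  rewrite cards_draws card_interval; apply: leq_bin2l; lia.
rewrite -(card_subsets_above n a); apply: leq_trans (leq_mul cP (leqnn _)).
rewrite -cardsX.
apply: leq_trans (leq_imset_card (fun p : {set 'I_n} * {set 'I_n} => p.1 :|: p.2) _).
apply/subset_leq_card/subsetP => e /setIdP[eF ea].
have := blocked_two_low k0 shF Fk bF eF ea; rewrite -/R => e2.
have /card_gt0P[A] : 0 < #|[set A : {set 'I_n} | A \subset e :&: R & #|A| == 2]|.
  by rewrite cards_draws bin_gt0.
rewrite inE subsetI => /andP[/andP[Ae AR] A2].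
apply/imsetP; exists (A, e :\: A); last by rewrite /= -{1}(setID e A) (setIidPr Ae).
rewrite inE !inE /= AR A2 cardsD (setIidPr Ae) (eqP A2) Fk // eqxx !andbT /=.
by apply: subset_trans ea; apply: subsetDl.
Qed.

(** For [s > 0] and [k > 1] the right side is at least ['C(n - a - 1, k - 1)], which outgrows the
    order [k - 2] of the bound in [blocked_card]. For [s = 0] there are no pairs of low vertices,
    and for [k = 1] no edge contains two vertices. *)
Lemma blocked_small F : 0 < k -> shifted 0 F -> (forall e, e \in F -> #|e| = k) -> blocked F ->
  (1 < k -> 2 * k * 'C(k * s + 1, 2) + 2 * k + 1 <= n - a) ->
  #|[set e in F | e \subset above n a]| <= 'C(n - a, k) - 'C(n - a - s, k).
Proof.
move=> k0 shF Fk bF nbig.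
have cardF := blocked_card k0 shF Fk bF.
have [s0|s0] := posnP s.
  by apply: leq_trans cardF _; rewrite s0 muln0 mul0n.
have [k1|k1] := leqP k 1.
  rewrite (_ : [set _ in _ | _] = set0) ?cards0 //; apply/setP => e; rewrite in_set0.
  apply/negP => /setIdP[eF ea]; have := blocked_two_low k0 shF Fk bF eF ea.
  have := subset_leq_card (subsetIl e [set z : 'I_n | a <= z < a + 1 + k * s]).
  by rewrite (Fk _ eF); lia.
apply: (leq_trans cardF).
have {}nbig := nbig k1; move: nbig {cardF bF Fk shF}; case: k k0 k1 => [|[|j]] // _ _.
rewrite subSS subSS subn0; move: 'C(_, 2) => q.
case: (n - a) => [|M] // Mq; first by lia.
have h1 : 'C(M.+1 - s, j.+2) <= 'C(M, j.+2) by apply: leq_bin2l; lia.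
have h2 : q * 'C(M.+1, j) <= 'C(M, j.+1).
  have e1 : M.+1 * 'C(M, j) = (M.+1 - j) * 'C(M.+1, j) by rewrite mul_bin_down.
  have e2 : j.+1 * 'C(M, j.+1) = (M - j) * 'C(M, j) by rewrite mul_bin_left.
  have e3 : 'C(M.+1, j) <= 2 * 'C(M, j).
    rewrite -(@leq_pmul2l (M.+1 - j)); last by lia.
    rewrite -e1 mulnA leq_mul2r; apply/orP; right; lia.
  rewrite -(@leq_pmul2l j.+1) // e2.
  apply: (@leq_trans (j.+1 * (q * (2 * 'C(M, j))))).
    by rewrite !leq_mul2l e3 !orbT.
  have -> : j.+1 * (q * (2 * 'C(M, j))) = (2 * j.+1 * q) * 'C(M, j) by ring.
  rewrite leq_mul2r; apply/orP; right; nia.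
rewrite binS; lia.
Qed.

End Blocked.

(** The edges lost in passing from [a] to [a + h] are among all [k]-sets above [a] that meet the [h]
    dropped vertices. *)
Lemma card_above_split n a h k (F : {set {set 'I_n}}) : (forall e, e \in F -> #|e| = k) ->
  #|[set e in F | e \subset above n a]| + 'C(n - (a + h), k) <=
  #|[set e in F | e \subset above n (a + h)]| + 'C(n - a, k).
Proof.
move=> Fk; rewrite -!(card_subsets_above n) -!(addnC #|subsets_above _ _ _|).
have sub : subsets_above n (a + h) k \subset subsets_above n a k.
  apply/subsetP => e; rewrite !inE => /andP[ea ->]; rewrite andbT.
  by apply: subset_trans ea _; apply/subsetP => z; rewrite !inE; lia.
rewrite -[in leqRHS](cardsID (subsets_above n (a + h) k) (subsets_above n a k)) (setIidPr sub).
rewrite -addnA leq_add2l.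
rewrite -(cardsID (subsets_above n (a + h) k) [set e in F | e \subset above n a]) addnC.
apply: leq_add; apply/subset_leq_card/subsetP => e.
  by move=> /setDP[/setIdP[eF ea] nea]; rewrite inE nea inE ea Fk ?eqxx.
by move=> /setIP[/setIdP[eF _]]; rewrite !inE eF => /andP[].
Qed.

(** Dropping the [h] lowest vertices costs at most [h * 'C(n - a - s, k - 1)] in the size bound.
    Without a matching, [matching_free_bound] yields a gain from blocking of the same order times
    [s], and the hypothesis relating [h] to [s] makes the gain prevail. *)
Lemma blocked_large n a h k s (F : {set {set 'I_n}}) : 1 < k -> 0 < s ->
  h * (6 * k * 4 ^ (k - 1)) <= s ->
  shifted 0 F -> (forall e, e \in F -> #|e| = k) -> blocked a k s F ->
  2 * k * s.+1 < n - a ->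
  'C(n - a, k) - 'C(n - a - s, k) < #|[set e in F | e \subset above n a]| ->
  has_rainbow_matching
    (fun _ : 'I_s.+1 => [set e in F | e \subset above n (a + h)]).
Proof.
case: k => // k k0 s0 hD shF Fk bF nbig Fbig; rewrite ltnS in k0; rewrite subSS subn0 in hD.
set F' := [set e in F | e \subset above n (a + h)].
have [//|nm] := rainbow_matching_dec (fun _ : 'I_s.+1 => F').
exfalso.
have p4 : 0 < 4 ^ k by rewrite expn_gt0.
have h12 : 12 * h <= s.
  apply: leq_trans hD; rewrite mulnC leq_mul2l; apply/orP; right.
  by move: (4 ^ k) p4 => p p4; nia.
have ks : s.+1 <= k * s.+1 by apply: leq_pmull.
have nbig' : 2 * (k * s.+1) + 2 * s.+1 < n - a by move: nbig; nia.
(* The slack of [N] over [2 * s + 1] will be [x + 1]: small enough for [N * k] vertices to fit, and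
   large enough for [N <= 6 * k.+1 * x.+1]. *)
pose x := s.+1 %/ (2 * k.+1).
have xk : x * k + x <= s.+1 by have := leq_trunc_div s.+1 (2 * k.+1); rewrite -/x; nia.
have x1 : s.+1 <= 2 * k.+1 * x.+1 by have := ltn_ceil s.+1 (isT : 0 < 2 * k.+1); rewrite -/x; nia.
have xs : x <= s.+1 by lia.
pose N := 2 * s.+1 + x.
have xk2 : 2 * (x * k) <= s.+1.
  by have := leq_trunc_div s.+1 (2 * k.+1); rewrite -/x; nia.
have bsn : a + h + s < n by lia.
have hmain : N * (#|F'| + 'C(n - (a + h + s), k.+1)) +
    s * 'C(n - (a + 1 + k.+1 * s), k) * (N - (2 * s + 1)) <= N * 'C(n - (a + h), k.+1).
  apply: (@matching_free_bound n (a + h) s k bsn F' N (a + 1 + k.+1 * s) k0).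
  - by move=> e /setIdP[eF ea]; rewrite inE ea Fk ?eqxx.
  - move=> e y z /setIdP[eF ea] ye ze az zy; apply/setIdP; split; first exact: shF.
    rewrite subUset sub1set inE az /=; apply: subset_trans ea; exact: subD1set.
  - exact: nm.
  - by rewrite /N mulnDl -mulnA; move: nbig' xk2 h12; lia.
  - by rewrite /N; lia.
  - by have := leq_pmull s k0; rewrite mulSn; lia.
  (* An edge through [a + h] could be shifted to [a], so blocking passes from [a] to [a + h]. For
     [h = 0] the two vertices coincide. *)
  - move=> v B vah Bc; apply/negP => /setIdP[vBF _].
    have an : a < n by lia.
    have := bF (Ordinal an) B erefl Bc.
    have [h0|h0] := posnP h.
      have -> : Ordinal an = v by apply: val_inj; rewrite /= vah h0 addn0.
      by rewrite vBF.
    have vB : v \notin B.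
      by apply/negP => /(subsetP Bc); rewrite inE vah; nia.
    have aB : Ordinal an \notin B by apply/negP => /(subsetP Bc); rewrite inE /=; lia.
    case/negP; rewrite -(setU1K vB); apply: shF => //; rewrite ?setU11 //=; last by lia.
    by rewrite !inE negb_or aB andbT -val_eqE /= vah; lia.
move: hmain.
have := @card_above_split n a h k.+1 F Fk; rewrite -/F'.
have := bin_increment (n - a - s - h) h k.
have -> : n - a - s - h + h = n - a - s by lia.
have -> : n - (a + h + s) = n - a - s - h by lia.
have := @bin_ratio (n - a - s) (n - (a + 1 + k.+1 * s)) k.
have -> : (n - a - s <= 4 * (n - (a + 1 + k.+1 * s) - k)) = true.
  apply/idP; move: nbig; nia.
have -> : N - (2 * s + 1) = x.+1 by rewrite /N; lia.
move: ('C(n - (a + 1 + k.+1 * s), k)) ('C(n - a - s, k)) => bb C0 /(_ isT) hC0.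
move: ('C(n - a - s - h, k.+1)) ('C(n - a - s, k.+1)) Fbig => A1 A2 Fbig.
move: ('C(n - (a + h), k.+1)) ('C(n - a, k.+1)) Fbig => A3 A4.
move: #|F'| #|_| => f' fa Fbig hinc hsplit hmain.
(* The summand [N] comes from the strictness of [Fbig]. By [e1] and [e2] the right side is at most
   [s * bb * x.+1], which forces [N = 0]. *)
have key : N + s * bb * x.+1 <= N * (h * C0).
  have : N * (A3 + 1) <= N * (f' + A1 + h * C0) by rewrite leq_mul2l; apply/orP; right; lia.
  move: hmain; rewrite !mulnDr muln1; lia.
have N3 : N <= 6 * k.+1 * x.+1.
  have -> : 6 * k.+1 * x.+1 = 3 * (2 * k.+1 * x.+1) by ring.
  by apply: leq_trans (leq_mul (leqnn 3) x1); rewrite /N; lia.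
have e1 : N * (h * C0) <= 6 * k.+1 * x.+1 * (h * (4 ^ k * bb)).
  by apply: leq_mul => //; rewrite leq_mul2l hC0 orbT.
have e2 : 6 * k.+1 * x.+1 * (h * (4 ^ k * bb)) <= s * bb * x.+1.
  have -> : 6 * k.+1 * x.+1 * (h * (4 ^ k * bb)) = h * (6 * k.+1 * 4 ^ k) * (bb * x.+1) by ring.
  by rewrite -[leqRHS]mulnA leq_mul2r hD orbT.
have : 0 < N by rewrite /N.
lia.
Qed.

(** * Induction *)

(* For [s >= large_size k], the depth [h] of [blocked_large], about [s] divided by
   [6 * k * 4 ^ (k - 1)], satisfies the requirement [6 * k ^ 3 * s.+1 ^ 2 < h ^ 3] of
   [select_light]. *)
Definition large_size (k : nat) := 48 * k ^ 3 * (6 * k * 4 ^ (k - 1)) ^ 3.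

(** The ground size that [blocked_small] requires for all [s <= large_size k]. *)
Definition large_ground (k : nat) := 2 * k * 'C(k * large_size k + 1, 2) + 2 * k + 1.

(** From [s.+1 <= 2 * (s %/ d) * d], cubed, and [48 = 8 * 6]. *)
Lemma cube_divn_gt k d s : 0 < k -> 0 < d -> 48 * k ^ 3 * d ^ 3 < s.+1 ->
  6 * k ^ 3 * s.+1 ^ 2 < (s %/ d) ^ 3.
Proof.
move=> k0 d0 big; set h := s %/ d.
have sh : s.+1 <= h.+1 * d by apply: ltn_ceil.
have kd : 0 < k ^ 3 by rewrite expn_gt0 k0.
have dd : d <= d ^ 3 by rewrite -[leqLHS]expn1 leq_pexp2l.
have ds : d < s.+1.
  apply: leq_ltn_trans big; apply: (leq_trans dd); apply: leq_pmull.
  by rewrite muln_gt0.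
have h0 : 0 < h by rewrite lt0n; apply: contraTneq sh => ->; rewrite mul1n -ltnNge.
have s2 : s.+1 <= 2 * h * d by apply: (leq_trans sh); rewrite leq_mul2r; lia.
have d30 : 0 < 8 * d ^ 3 by rewrite muln_gt0 expn_gt0 d0.
rewrite -(ltn_pmul2l d30).
apply: (@leq_trans (s.+1 ^ 3)); last first.
  by have := @leq_exp2r _ _ 3 isT; move/(_ s.+1 (2 * h * d)); rewrite s2 !expnMn mulnAC => ->.
have -> : 8 * d ^ 3 * (6 * k ^ 3 * s.+1 ^ 2) = 48 * k ^ 3 * d ^ 3 * s.+1 ^ 2 by ring.
by rewrite [X in _ < X](_ : _ = s.+1 * s.+1 ^ 2) ?ltn_pmul2r ?expn_gt0 // expnS.
Qed.

Lemma shifted_weaken n b (F : {set {set 'I_n}}) : shifted 0 F -> shifted b F.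
Proof. by move=> shF e x y eF xe ye _; apply: shF. Qed.

Section RainbowAbove.
Variables (n k : nat) (I : finType) (F : I -> {set {set 'I_n}}).
Hypothesis k0 : 0 < k.
Hypothesis F_shifted : forall i, shifted 0 (F i).
Hypothesis F_card : forall i e, e \in F i -> #|e| = k.

(** The bottom [a] and the index set [J] let the induction discard one vertex and one family
    together, which leaves [n - a + 1 - #|J|] unchanged. *)
Lemma rainbow_above (J : {set I}) a :
  large_ground k + #|J| <= n - a -> 2 * k * #|J| < n - a ->
  (forall i, i \in J ->
    'C(n - a, k) - 'C(n - a + 1 - #|J|, k) < #|[set e in F i | e \subset above n a]|) ->
  exists g : I -> {set 'I_n}, [/\ forall i, i \in J -> g i \in F i,
    forall i, i \in J -> g i \subset above n a &
    forall i j, i \in J -> j \in J -> i != j -> [disjoint g i & g j]].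
Proof.
have [m] := ubnP #|J|; elim: m J a => // m IH J a /ltnSE Jm nJ nkJ FJ.
have [->|/set0Pn[i0 i0J]] := eqVneq J set0.
  by exists (fun=> set0); split=> i; rewrite inE.
have [s Js] : exists s, #|J| = s.+1 by exists #|J :\ i0|; rewrite (cardsD1 i0 J) i0J.
have nas : n - a + 1 - s.+1 = n - a - s by lia.
have [/existsP[i /existsP[v /existsP[B /and4P[iJ /eqP va Bc vB]]]]|] :=
    boolP [exists i, [exists v : 'I_n, [exists B : {set 'I_n},
      [&& i \in J, v == a :> nat, B \subset above n (a + 1 + k * s) & v |: B \in F i]]]].
  have JiS : #|J :\ i| = s by have := cardsD1 i J; rewrite iJ Js => -[].
  have iS j : j \in J :\ i -> j \in J by case/setD1P.
  have [||||g [gF ga gd]] := IH (J :\ i) (a + 1).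
  - by rewrite JiS; lia.
  - by rewrite JiS; lia.
  - rewrite JiS; move: nkJ; rewrite Js mulnS; lia.
  (* Each family loses at most ['C(n - a, k) - 'C(n - (a + 1), k)] edges. Since [s > 0], the
     truncated differences subtract correctly. *)
  - move=> j jJi; have jJ := iS j jJi.
    have s0 : 0 < s by rewrite -JiS; apply/card_gt0P; exists j.
    rewrite JiS; have := FJ j jJ; rewrite Js nas.
    have := @card_above_split n a 1 k (F j) (F_card (i := j)).
    have -> : n - (a + 1) + 1 - s = n - a - s by lia.
    have : 'C(n - a - s, k) <= 'C(n - (a + 1), k) by apply: leq_bin2l; lia.
    have : 'C(n - (a + 1), k) <= 'C(n - a, k) by apply: leq_bin2l; lia.
    by lia.
  have gl q : a + 1 <= q -> load (J :\ i) g q + (a + 1) <= q.+1.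
    by move=> aq; have := load_disjoint q ga gd; lia.
  (* The settled edges lie from [a + 1] to [a + k * s], below [B] and above [v]. *)
  have [||g' [g'F g'a g'low g'd]] := settle (k := k) _ _ gF ga gl.
  - by move=> j _; apply: shifted_weaken.
  - by move=> j e _; apply: F_card.
  have vdis j : j \in J :\ i -> [disjoint v |: B & g' j].
    move=> jJ; rewrite disjoints_subset; apply/subsetP => x; rewrite in_setC.
    have [xg|//] := boolP (x \in g' j).
    have := g'low j x jJ xg; have := subsetP (g'a j jJ) _ xg; rewrite JiS !inE.
    move=> ax xl /orP[/eqP xv|/(subsetP Bc)]; last by rewrite inE; lia.
    by rewrite xv va in ax; lia.
  exists (fun j => if j == i then v |: B else g' j); split=> [j jJ|j jJ|j j' jJ j'J jj'].
  - by case: eqP => [->//|/eqP ji]; apply: g'F; rewrite in_setD1 ji.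
  - case: eqP => [_|/eqP ji].
      rewrite subUset sub1set inE va leqnn /=; apply: subset_trans Bc _.
      by apply/subsetP => x; rewrite !inE; lia.
    apply: subset_trans (g'a j _) _; first by rewrite in_setD1 ji.
    by apply/subsetP => x; rewrite !inE; lia.
  - case: (eqVneq j i) => [ji|ji]; case: (eqVneq j' i) => [j'i|j'i].
    + by rewrite ji j'i eqxx in jj'.
    + by apply: vdis; rewrite in_setD1 j'i.
    + by rewrite disjoint_sym; apply: vdis; rewrite in_setD1 ji.
    + by apply: g'd; rewrite // in_setD1 ?ji ?j'i.
rewrite negb_exists => /forallP nex.
have bF i : i \in J -> blocked a k s (F i).
  move=> iJ v B va Bc; apply/negP => vB; case/negP: (nex i).
  apply/existsP; exists v; apply/existsP; exists B.
  by rewrite iJ va eqxx Bc vB.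
rewrite Js nas in FJ.
have small : (1 < k -> 2 * k * 'C(k * s + 1, 2) + 2 * k + 1 <= n - a) -> False.
  move=> /(blocked_small k0 (F_shifted (i := i0)) (F_card (i := i0)) (bF i0 i0J)).
  by have := FJ i0 i0J; lia.
have [k1|k1] := leqP k 1; first by case: small; lia.
(* For bounded [s] the ground set is large enough to apply [small]; for large [s] one edge is
   selected from each matching given by [blocked_large]. *)
have [ls|sl] := leqP s (large_size k).
  case: small => _; apply: leq_trans nJ; apply: leq_trans (leq_addr _ _).
  rewrite /large_ground !leq_add2r leq_mul2l; apply/orP; right; apply: leq_bin2l.
  by rewrite leq_add2r leq_mul2l ls orbT.
have d0 : 0 < 6 * k * 4 ^ (k - 1) by rewrite !muln_gt0 k0 expn_gt0.
pose h := s %/ (6 * k * 4 ^ (k - 1)).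
have hs : h * (6 * k * 4 ^ (k - 1)) <= s by apply: leq_trunc_div.
have [M MP] : exists M : I -> 'I_s.+1 -> {set 'I_n}, forall i, i \in J ->
    (forall l, M i l \in [set e in F i | e \subset above n (a + h)]) /\
    (forall l l', l != l' -> [disjoint M i l & M i l']).
  apply: (fin_all_exists (P := fun i M => i \in J ->
    (forall l, M l \in [set e in F i | e \subset above n (a + h)]) /\
    (forall l l', l != l' -> [disjoint M l & M l']))) => i.
  have [iJ|_] := boolP (i \in J); last by exists (fun=> set0).
  have [||M [MF Md]] := blocked_large k1 _ hs (F_shifted (i := i)) (F_card (i := i))
    (bF i iJ) _ (FJ i iJ).
  - by lia.
  - by rewrite -Js.
  by exists M.
have MF i l : i \in J -> M i l \in F i by move=> /MP[/(_ l)/setIdP[]].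
have Ma i l : i \in J -> M i l \subset above n (a + h) by move=> /MP[/(_ l)/setIdP[]].
have [|||||c cl] := @select_light n I J k a h s.+1 M k0 isT Js.
- by apply: leq_trans (leqnSn s); apply: leq_div.
- by apply: cube_divn_gt => //; apply: leq_trans sl _.
- by move=> i l iJ; apply/F_card/MF.
- exact: Ma.
- by move=> i l l' /MP[_]; apply.
have [||||g [gF ga _ gd]] := settle (k := k) (a := a) (F := F) _ _ _ _ cl.
- by move=> j _; apply: shifted_weaken.
- by move=> j e _; apply: F_card.
- by move=> i iJ; apply: MF.
- move=> i iJ; apply: subset_trans (Ma i _ iJ) _.
  by apply/subsetP => x; rewrite !inE; lia.
by exists g.
Qed.

End RainbowAbove.

Theorem theorem1p3 :
  forall k : nat, 0 < k ->
  exists n0 : nat,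
  forall n t : nat, 0 < n -> 0 < t -> n0 <= n -> 2 * k * t < n ->
  forall F : 'I_t -> {set {set 'I_n}},
    (forall i, F i \subset ksubsets n k) ->
    (forall i, 'C(n, k) - 'C(n - t + 1, k) < #|F i|) ->
    has_rainbow_matching F.
Proof.
(* The ground size and [t] are each at most half of [n], so their sum is at most [n], as
   [rainbow_above] requires. *)
move=> k k0; exists (2 * large_ground k) => n t n0 t0 nbig nt F FK Fbig.
have [G [shG GK GF]] := exists_shifted FK; apply.
have Gk i e : e \in G i -> #|e| = k by move=> /(subsetP (GK i)); rewrite inE => /eqP.
have tn : 2 * t < n.
  by apply: leq_ltn_trans nt; rewrite leq_mul2r; apply/orP; right; rewrite leq_pmulr.
have [||i _|g [gG _ gd]] := @rainbow_above n k _ G k0 shG Gk [set: 'I_t] 0.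
- by rewrite cardsT card_ord; lia.
- by rewrite cardsT card_ord subn0.
- rewrite cardsT card_ord subn0.
  have -> : [set e in G i | e \subset above n 0] = G i.
    apply/setP => e; rewrite inE; case: (e \in G i) => //=.
    by apply/subsetP => x; rewrite inE.
  rewrite GF; have -> : n + 1 - t = n - t + 1 by lia.
  exact: Fbig.
exists g; split=> [i|i j ij]; first by apply: gG; rewrite inE.
by apply: gd; rewrite // inE.
Qed.
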